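(* Let $G$ be a group with a finite-index subgroup $H$ that admits a proper cocompact action on a CAT(0) cube complex $X$. Suppose that the coarse median structure on $G$ induced by the cubulation $H\curvearrowright X$ is $G$-invariant. Then $G$ admits a proper cocompact action on a CAT(0) cube complex.
   Context: The vertex set of a CAT(0) cube complex $X$, with the combinatorial metric $d$ of the $1$-skeleton, carries a median operator $m$: $m(x,y,z)$ is the unique vertex lying on a combinatorial geodesic between each two of $x,y,z$. The proper cocompact action $H\curvearrowright X$ induces a coarse median $\mu_H\colon H^3\to H$: for a fixed vertex $p$, $\mu_H(h_1,h_2,h_3)$ is any element such that $d\big(\mu_H(h_1,h_2,h_3)p,m(h_1p,h_2p,h_3p)\big)$ is uniformly bounded. Since $H$ has finite index in $G$, the inclusion $H\hookrightarrow G$ is a quasi-isometry; let $r\colon G\to H$ be a coarse inverse (a map moving points a uniformly bounded distance in a word metric on $G$). The coarse median structure on $G$ induced by the cubulation of $H$ is the class, up to uniformly bounded distance, of $\mu(g_1,g_2,g_3)=\mu_H(r(g_1),r(g_2),r(g_3))$. It is $G$-invariant if for each $g\in G$ there is a constant $C(g)\ge 0$ such that $g\mu(g_1,g_2,g_3)$ and $\mu(gg_1,gg_2,gg_3)$ are at distance $\le C(g)$ in a word metric on $G$, for all $g_1,g_2,g_3\in G$. *)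

(* Defs.v *)
From mathcomp Require Import all_boot.
From mathcomp Require Import boolp classical_sets cardinality.

Set Implicit Arguments.
Unset Strict Implicit.
Unset Printing Implicit Defensive.

Local Open Scope group_scope.
Local Open Scope classical_set_scope.

Section Graph.
Variables (T : Type) (e : T -> T -> Prop).

Definition edge_path (x : T) (p : seq T) : bool :=
  path (fun u v => `[< e u v >]) x p.

Definition walk (n : nat) (x y : T) : Prop :=
  exists p : seq T, [/\ edge_path x p, last x p = y & size p = n].

Definition graph_connected : Prop := forall x y, exists n, walk n x y.

(* The default value 0 is only taken when y cannot be reached from x; the
   graphs considered below are connected, so this never happens for them. *)
Definition gdist (x y : T) : nat :=
  xget 0%N [set n | walk n x y /\ forall k, walk k x y -> (n <= k)%N].

Definition on_geodesic (v x y : T) : Prop :=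
  exists m n, [/\ walk m x v, walk n v y & (m + n)%N = gdist x y].

Definition is_median (x y z v : T) : Prop :=
  [/\ on_geodesic v x y, on_geodesic v y z & on_geodesic v z x].

End Graph.

(* [{ffun 'I_n -> bool}] is the vertex set of the standard cube [0,1]^n.  For
   injective s, [face_map s b] is the inclusion of the k-dimensional face
   through b spanned by the directions s i, sending the origin to b.  For
   k = n these are exactly the symmetries of the n-cube. *)
Definition face_map (k n : nat) (s : 'I_k -> 'I_n) (b : {ffun 'I_n -> bool})
    (x : {ffun 'I_k -> bool}) : {ffun 'I_n -> bool} :=
  [ffun j => b j (+) [exists i, (s i == j) && x i]].

(* A complex of cubes that are embedded and meet pairwise in the empty set or
   in a common face (Bridson--Haefliger, I.7.32), as every CAT(0) cube complex
   is.  Such a complex is determined by its vertices together with the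
   characteristic maps of its cubes restricted to the vertices: [cube f] says
   that f : {0,1}^n -> X is the characteristic map of an n-cube, for one of
   the parametrizations of that cube by [0,1]^n. *)
Record cubeComplex := CubeComplex {
  vertex :> Type;
  cube : forall n, ({ffun 'I_n -> bool} -> vertex) -> Prop;
  cube_vertex : forall f : {ffun 'I_0 -> bool} -> vertex, cube f;
  cube_inj : forall n (f : {ffun 'I_n -> bool} -> vertex),
    cube f -> injective f;
  cube_face : forall k n (s : 'I_k -> 'I_n) (b : {ffun 'I_n -> bool})
      (f : {ffun 'I_n -> bool} -> vertex),
    injective s -> cube f -> cube (f \o face_map s b);
  cube_meet : forall m n (f : {ffun 'I_m -> bool} -> vertex)
      (g : {ffun 'I_n -> bool} -> vertex),
    cube f -> cube g -> (exists u w, f u = g w) ->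
    exists k (s : 'I_k -> 'I_m) a (t : 'I_k -> 'I_n) b,
      [/\ injective s, injective t,
          f \o face_map s a =1 g \o face_map t b &
          forall u w, f u = g w ->
            exists x, u = face_map s a x /\ w = face_map t b x]
}.

Arguments cube {_} [n] f.

Definition square_corner (a b : bool) : {ffun 'I_2 -> bool} :=
  [ffun i : 'I_2 => if i == ord0 then a else b].

Section CubeComplex.
Variable X : cubeComplex.

Definition adjacent (x y : X) : Prop :=
  exists f : {ffun 'I_1 -> bool} -> X,
    [/\ cube f, f [ffun=> false] = x & f [ffun=> true] = y].

(* Combinatorial homotopy rel endpoints of edge paths in the 2-skeleton; a path
   is given by the sequence of all its vertices. *)
Inductive homotopic : seq X -> seq X -> Prop :=
| homotopic_refl p : homotopic p p
| homotopic_sym p q : homotopic p q -> homotopic q p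
| homotopic_trans q p r : homotopic p q -> homotopic q r -> homotopic p r
| homotopic_backtrack p q x y :
    adjacent x y -> homotopic (p ++ [:: x; y; x] ++ q) (p ++ [:: x] ++ q)
| homotopic_square p q (f : {ffun 'I_2 -> bool} -> X) :
    cube f ->
    homotopic
      (p ++ [:: f (square_corner false false); f (square_corner true false);
                f (square_corner true true)] ++ q)
      (p ++ [:: f (square_corner false false); f (square_corner false true);
                f (square_corner true true)] ++ q).

Definition simply_connected : Prop :=
  [/\ exists x : X, True,
      graph_connected adjacent &
      forall (x : X) (p : seq X),
        edge_path adjacent x p -> last x p = x -> homotopic (x :: p) [:: x]].

(* The link of v is the simplicial complex with the neighbours of v as
   vertices: u_0, ..., u_(n-1) span a simplex when the edges from v to the u_i
   are the edges at v of an n-cube. *)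
Definition link_simplex (v : X) (n : nat) (u : 'I_n -> X) : Prop :=
  exists f : {ffun 'I_n -> bool} -> X,
    [/\ cube f, f [ffun=> false] = v &
        forall i, f [ffun j => j == i] = u i].

Definition flag_link (v : X) : Prop :=
  forall n (u : 'I_n -> X),
    (forall i, link_simplex v (tnth [tuple u i])) ->
    (forall i j, i != j -> link_simplex v (tnth [tuple u i; u j])) ->
    link_simplex v u.

(* CAT(0) for cube complexes, in the combinatorial sense: non-positively curved
   (flag links) and simply connected. *)
Definition CAT0 : Prop := simply_connected /\ forall v : X, flag_link v.

End CubeComplex.

Section Action.
Variables (G : groupType) (X : cubeComplex) (act : G -> X -> X).

Definition cubical_action : Prop :=
  [/\ forall x, act 1 x = x,
      forall g h x, act (g * h) x = act g (act h x) &
      forall g n (f : {ffun 'I_n -> bool} -> X), cube f -> cube (act g \o f)].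

(* A finite set K of vertices stands for the finite subcomplex formed by the
   cubes with all vertices in K; two subcomplexes that meet share a vertex. *)
Definition proper_action : Prop :=
  forall K : set X, finite_set K ->
    finite_set [set g | exists2 x, K x & K (act g x)].

(* Every cube, not just every vertex, has a translate in the finite subcomplex
   spanned by K. *)
Definition cocompact_action : Prop :=
  exists2 K : set X, finite_set K &
    forall n (f : {ffun 'I_n -> bool} -> X), cube f ->
      exists g, forall x, K (act g (f x)).

Definition proper_cocompact_cubical_action : Prop :=
  [/\ cubical_action, proper_action & cocompact_action].

End Action.

Section WordMetric.
Variables (G : groupType) (S : set G).

Definition finite_generating_set : Prop :=
  finite_set S /\
  forall g : G, exists2 w : seq G,
    (forall x, x \in w -> S x \/ S x^-1) & g = \prod_(x <- w) x.

Definition cayley_edge (g h : G) : Prop :=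
  exists2 s, S s \/ S s^-1 & h = g * s.

Definition word_dist : G -> G -> nat := gdist cayley_edge.

Definition close (mu nu : G -> G -> G -> G) : Prop :=
  exists C : nat, forall g1 g2 g3,
    (word_dist (mu g1 g2 g3) (nu g1 g2 g3) <= C)%N.

Definition left_invariant (mu : G -> G -> G -> G) : Prop :=
  forall g, exists C : nat, forall g1 g2 g3,
    (word_dist (g * mu g1 g2 g3)%g
       (mu (g * g1)%g (g * g2)%g (g * g3)%g) <= C)%N.

End WordMetric.

Definition finite_index (G : groupType) (P : pred G) : Prop :=
  exists2 T : set G, finite_set T &
    forall g, exists t h, [/\ T t, P h & g = t * h].

(* Three vertices of a CAT(0) cube complex have exactly one median, so v below
   is m(h1 p, h2 p, h3 p). *)
Definition orbit_coarse_median (H : groupType) (X : cubeComplex)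
    (act : H -> X -> X) (p : X) (muH : H -> H -> H -> H) : Prop :=
  exists C : nat, forall h1 h2 h3 v,
    is_median (@adjacent X) (act h1 p) (act h2 p) (act h3 p) v ->
    (gdist (@adjacent X) (act (muH h1 h2 h3) p) v <= C)%N.

Definition coarse_inverse (G : groupType) (S : set G) (P : pred G)
    (H : subGroupType P) (r : G -> H) : Prop :=
  exists C : nat, forall g, (word_dist S g (val (r g)) <= C)%N.

(* The coarse median structure on G induced by the action of H on X, as the
   set of its representatives. *)
Definition induced_coarse_median (G : groupType) (S : set G) (P : pred G)
    (H : subGroupType P) (X : cubeComplex) (act : H -> X -> X) :
    set (G -> G -> G -> G) :=
  [set mu | exists p muH r,
     [/\ orbit_coarse_median act p muH, @coarse_inverse G S P H r &
         close S mu
           (fun g1 g2 g3 => val (muH (r g1) (r g2) (r g3)))]].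

(* Main.v *)
Require Import Defs.
From mathcomp Require Import all_boot zify.
From mathcomp Require Import boolp classical_sets cardinality.

(** The proof follows the idea that a coarsely median-closed orbit can be
thickened to an honest median algebra without leaving a bounded neighbourhood.

Vertices of X carry a median. The group G acts by translation on the
H-equivariant maps G -> X (the coinduced action, a twisted product of finitely
many copies of X), and pointwise medians are G-equivariant. The orbit map of
[base] sends g, in the coordinate t, to h p with h in H at bounded distance from
t^-1 g, so invariance of the coarse median structure makes medians of orbit
points stay uniformly close to the orbit ([orbit_coarse_subalgebra]). Let Y be
the median algebra generated by the orbit. It is G-invariant by construction, and the two things to be seen
are that Y is the vertex set of a CAT(0) cube complex ([cubulation_CAT0]) and that
Y stays close to the orbit ([in_hull_near_orbit]), which makes the action
cocompact; properness is inherited from H.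

Y stays close to the orbit because finitely many rounds of taking medians
already produce all of Y ([generated_level]). Indeed a point of Y is determined
by the sides of the boundedly many walls adjacent to its coordinates, so
recognising it only involves the subalgebra generated by the image of the orbit in
a finite Boolean cube of bounded dimension, where the process stabilises after
a bounded number of rounds. Each round moves away from the orbit by a
bounded amount because medians are Lipschitz. Cubes of Y are bounded since
the orbit is coarsely connected: projecting a chain of bounded steps to an edge
{x, y} of Y produces one step that jumps from x to y ([covers_near]).

The median on X has to be extracted from the two combinatorial conditions that
define CAT(0). Flag links allow a normal form for edge paths: a path is reduced
if square flips never create a backtrack, and appending an edge to a reduced
path either keeps it reduced or cancels an edge after some flips
([reduced_append]). This gives an operation that is invariant under homotopy
([homotopic_normal]), so, X being simply connected, two geodesics with the same
ends differ by square flips ([geodesics_flip]). With the cancellation lemma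
[flips_tail] this yields the quadrangle condition and the absence of K_(2,3) in
the 1-skeleton, which is bipartite because elementary homotopies preserve the
parity of the length. From those three properties alone one gets
convex halfspaces ([side_crossing], [side_convex]), medians ([median_exists]) and
the fact that halfspaces separate points and respect medians.

Conversely the algebras used here are those in which homomorphisms to
the two-element algebra separate points. Identities can then be checked by
Boolean case analysis, and cubes are the median-preserving maps whose edges
are two-point intervals. Cubes are built from their corners by taking joins
([corner_join]), and loops are contracted by comparing paths that move away from a
base point ([monotone_homotopic]). *)

Set Implicit Arguments.
Unset Strict Implicit.
Unset Printing Implicit Defensive.

(** * Distances in graphs *)

Section GraphDistance.
Variables (T : Type) (e : T -> T -> Prop).

Lemma walk0 x y : walk e 0 x y <-> x = y.
Proof.
split=> [[p [_ <- /size0nil ->]] //|->]; by exists [::].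
Qed.

Lemma walkS n x y : walk e n.+1 x y <-> exists2 z, e x z & walk e n z y.
Proof.
split=> [[[|z p] [//= /andP[/asboolP xz zp] pl [pn]]]|[z xz [p [zp pl pn]]]].
  by exists z => //; exists p.
by exists (z :: p); split=> //=; [apply/andP; split=> //; apply/asboolP|rewrite pn].
Qed.

Lemma walk1 x y : e x y -> walk e 1 x y.
Proof. by move=> xy; apply/walkS; exists y => //; apply/walk0. Qed.

Lemma walk_cat m n x y z : walk e m x y -> walk e n y z -> walk e (m + n) x z.
Proof.
elim: m x => [|m IH] x; first by move=> /walk0 ->.
move=> /walkS[t xt ty] yz; rewrite addSn; apply/walkS; exists t => //.
exact: IH.
Qed.

Hypothesis e_sym : forall x y, e x y -> e y x.
Hypothesis e_connected : graph_connected e.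

Local Notation d := (gdist e).

Lemma walk_sym n x y : walk e n x y -> walk e n y x.
Proof.
elim: n x y => [|n IH] x y; first by move=> /walk0 ->; apply/walk0.
move=> /walkS[z xz zy]; rewrite -addn1; apply: walk_cat (IH _ _ zy) _.
exact/walk1/e_sym.
Qed.

Lemma gdist_spec x y :
  walk e (d x y) x y /\ forall k, walk e k x y -> (d x y <= k)%N.
Proof.
rewrite /gdist.
case: xgetP => [n _ []//|none]; exfalso.
have ex : exists n, `[< walk e n x y >].
  by have [n xy] := e_connected x y; exists n; apply/asboolP.
case: (ex_minnP ex) => n /asboolP xy nmin.
by apply: (none n); split=> // k /asboolP /nmin.
Qed.

Lemma gdist_walk x y : walk e (d x y) x y.
Proof. exact: (gdist_spec x y).1. Qed.

Lemma gdist_le k x y : walk e k x y -> d x y <= k.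
Proof. exact: (gdist_spec x y).2. Qed.

Lemma gdist_refl x : d x x = 0.
Proof. by apply/eqP; rewrite -leqn0; apply: gdist_le; apply/walk0. Qed.

Lemma gdist_eq0 x y : d x y = 0 -> x = y.
Proof. by move=> xy; apply/walk0; rewrite -xy; exact: gdist_walk. Qed.

Lemma gdistC x y : d x y = d y x.
Proof.
by apply/eqP; rewrite eqn_leq; apply/andP; split; apply: gdist_le;
  apply: walk_sym; apply: gdist_walk.
Qed.

Lemma gdist_triangle y x z : d x z <= d x y + d y z.
Proof. by apply: gdist_le; apply: (@walk_cat _ _ _ y); apply: gdist_walk. Qed.

Lemma gdist_edge x y : e x y -> d x y <= 1.
Proof. by move=> xy; apply/gdist_le/walk1. Qed.

Lemma gdist_edge_le x y z : e x y -> d z y <= (d z x).+1.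
Proof.
move=> xy; have := gdist_triangle x z y; have := gdist_edge xy; lia.
Qed.

Lemma gdist_first_edge n x y : d x y = n.+1 -> exists2 z, e x z & d z y = n.
Proof.
move=> xy; have := gdist_walk x y; rewrite xy => /walkS[z xz zy]; exists z => //.
apply/eqP; rewrite eqn_leq gdist_le //=.
have := gdist_triangle z x y; have := gdist_edge xz; lia.
Qed.

Lemma gdist_last_edge n x y : d x y = n.+1 -> exists2 z, e y z & d x z = n.
Proof.
rewrite gdistC => /gdist_first_edge[z yz zx]; exists z => //; by rewrite gdistC.
Qed.

Lemma on_geodesicE v x y : on_geodesic e v x y <-> d x v + d v y = d x y.
Proof.
split=> [[m [n [xv vy mn]]]|xvy].
  have := gdist_le xv; have := gdist_le vy; have := gdist_triangle v x y; lia.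
by exists (d x v), (d v y); split=> //; apply: gdist_walk.
Qed.

End GraphDistance.

(** * Walls and medians in graphs with the quadrangle property *)

Definition maj (a b c : bool) : bool := [|| a && b, b && c | c && a].

Section MedianGraph.
Variables (T : Type) (e : T -> T -> Prop).
Hypothesis e_sym : forall x y, e x y -> e y x.
Hypothesis e_connected : graph_connected e.
Local Notation d := (gdist e).
Hypothesis bipartite : forall o x y, e x y -> d o x != d o y.
Hypothesis quadrangle : forall o z a b, e z a -> e z b -> a <> b ->
  d o z = (d o a).+1 -> d o z = (d o b).+1 ->
  exists x, [/\ e a x, e b x & d o a = (d o x).+1].
Hypothesis no_K23 : forall z x a b c, z <> x -> a <> b ->
  e z a -> e a x -> e z b -> e b x -> e z c -> e c x -> c = a \/ c = b.

Let dC := gdistC e_sym e_connected.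
Let tri := gdist_triangle e_connected.

Lemma bipartite_step o x y : e x y -> d o y = (d o x).+1 \/ d o x = (d o y).+1.
Proof.
move=> xy; have := bipartite o xy; have := gdist_edge_le e_connected o xy.
have := gdist_edge_le e_connected o (e_sym xy); lia.
Qed.

Definition side (u v t : T) : bool := d t u < d t v.

Lemma sideN u v t : e u v -> side v u t = ~~ side u v t.
Proof. by move=> /(bipartite t); rewrite /side; lia. Qed.

Lemma side_l u v : e u v -> side u v u.
Proof.
move=> uv; have := bipartite u uv; have := gdist_refl e_connected u; rewrite /side; lia.
Qed.

Lemma side_r u v : e u v -> side u v v = false.
Proof. by move=> uv; rewrite /side (gdist_refl e_connected) ltn0. Qed.

(** If t lay on different sides of the two opposite edges, the quadrangle
condition seen from t would provide a third common neighbour of u and v',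
that is, a K_(2,3). *)
Lemma side_square_imp u v v' u' t : e u v -> e v v' -> e v' u' -> e u' u ->
  u <> v' -> v <> u' -> side u v t -> side u' v' t.
Proof.
move=> uv vv' v'u' u'u n1 n2; rewrite /side => tu.
have b1 := bipartite_step t uv; have b2 := bipartite_step t vv'.
have b3 := bipartite_step t v'u'; have b4 := bipartite_step t u'u.
rewrite ltnNge; apply/negP => tu'.
(* The distances from t force v to be farther than both u and v'. *)
have [||x [ux v'x dx]] := @quadrangle t v u v' (e_sym uv) vv' n1; try lia.
have [] := no_K23 n1 n2 uv vv' (e_sym u'u) (e_sym v'u') ux (e_sym v'x).
  by move=> ?; subst x; lia.
by move=> ?; subst x; lia.
Qed.

Lemma side_square u v v' u' : e u v -> e v v' -> e v' u' -> e u' u ->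
  u <> v' -> v <> u' -> side u v =1 side u' v'.
Proof.
move=> uv vv' v'u' u'u n1 n2 t; apply/idP/idP; first exact: side_square_imp.
by apply: side_square_imp; auto; apply/not_eq_sym.
Qed.

(** A wall is determined by any edge that crosses it. The edge u v is pushed
towards s t along a ladder of squares, and [side_square] keeps the halfspace
unchanged. *)
Lemma side_crossing u v s t : e u v -> e s t -> side u v s -> ~~ side u v t ->
  side u v =1 side s t.
Proof.
move: {2}(d u s) (erefl (d u s)) => k; elim: k u v => [|k IH] u v dus uv st.
  move/(gdist_eq0 e_connected): dus st => <- st _ tN.
  rewrite -(_ : t = v) //; apply/(gdist_eq0 e_connected).
  have := bipartite t uv.
  have := gdist_edge e_connected (e_sym st); move: tN; rewrite /side; lia.
rewrite {1 2}/side => su tu.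
have [u' uu' u's] := gdist_first_edge e_connected dus.
have b1 := bipartite_step t uv; have b2 := bipartite_step s uv.
have b3 := bipartite_step u st; have b4 := bipartite_step v st.
have b5 := bipartite_step u' st; have b6 := bipartite_step t uu'.
have := (dC u s, dC v s, dC u t, dC v t, dC u' s, dC u' t) => -[[[[[c1 c2] c3] c4] c5] c6].
have vu' : v <> u' by move=> ?; subst u'; lia.
have [||v' [vv' u'v' dv']] := @quadrangle t u v u' uv uu' vu'; try lia.
have uv' : u <> v' by move=> ?; subst v'; lia.
have sq := side_square uv vv' (e_sym u'v') (e_sym uu') uv' vu'.
move=> x; rewrite sq; apply: IH => //; first by rewrite -sq /side; lia.
by rewrite -sq /side; lia.
Qed.

Lemma crossing_edge (h : T -> bool) a c : h a -> ~~ h c ->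
  exists s t, [/\ e s t, h s, ~~ h t & d a s + (d t c).+1 = d a c].
Proof.
move: {2}(d a c) (erefl (d a c)) => k; elim: k a => [|k IH] a dac ha hc.
  by move: hc; rewrite -(gdist_eq0 e_connected dac) ha.
have [b ab bc] := gdist_first_edge e_connected dac.
case hb: (h b); last first.
  by exists a, b; split=> //; rewrite ?hb // (gdist_refl e_connected) bc dac.
have [s [t [st hs ht dst]]] := IH b bc hb hc.
exists s, t; split=> //.
have := tri b a s; have := gdist_edge e_connected ab; have := tri s a c.
have := tri t s c; have := gdist_edge e_connected st; lia.
Qed.

Definition between a c b := d a c + d c b = d a b.

Lemma betweenC a b c : between a c b -> between b c a.
Proof. by rewrite /between (dC b c) (dC c a) (dC b a) addnC. Qed.

(** A geodesic that leaves a halfspace does so through an edge s t; that halfspace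
is also the set of points closer to s than to t, so the far end of the geodesic,
being closer to t, cannot lie in it. *)
Lemma side_convex u v a b c : e u v -> side u v a -> side u v b ->
  between a c b -> side u v c.
Proof.
rewrite /between => uv ha hb acb; apply/negPn/negP => hc.
have [s [t [st hs ht dst]]] := crossing_edge ha hc.
have := hb; rewrite (side_crossing uv st hs ht) /side (dC b s) (dC b t).
have := tri t s b; have := tri c t b; have := tri s a b.
have := gdist_edge e_connected st; lia.
Qed.

Lemma side_between u v a b c : e u v -> between a c b ->
  side u v a = side u v b -> side u v c = side u v a.
Proof.
move=> uv acb; case ha: (side u v a) => /esym hb.
  exact: side_convex acb.
apply/negbTE; rewrite -(sideN c uv).
by apply: (side_convex (e_sym uv) _ _ acb); rewrite (sideN _ uv) ?ha ?hb.
Qed.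

Lemma separating_edge x y : x <> y ->
  exists v, [/\ e x v, side x v x & ~~ side x v y].
Proof.
move=> xy; case E: (d x y) => [|k].
  by move: (gdist_eq0 e_connected E).
have [v xv vy] := gdist_first_edge e_connected E.
by exists v; split; rewrite ?side_l // /side (dC y x) (dC y v); lia.
Qed.

Definition median_point a b c v := [/\ between a v b, between b v c & between c v a].

Lemma side_median_point u v a b c w : e u v -> median_point a b c w ->
  side u v w = maj (side u v a) (side u v b) (side u v c).
Proof.
move=> uv [/(side_between uv) h1 /(side_between uv) h2 /(side_between uv) h3].
by move: h1 h2 h3; rewrite /maj; do 4!case: (side u v _) => //;
   do ?[move=> /(_ erefl)] => //; auto.
Qed.

Lemma median_point_uniq a b c w w' :
  median_point a b c w -> median_point a b c w' -> w = w'.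
Proof.
move=> mw mw'; apply: contrapT => /separating_edge[v [uv hw]].
by rewrite (side_median_point uv mw') -(side_median_point uv mw) hw.
Qed.

Lemma between_trans u v' v m : between u v' v -> between u m v' -> between u m v.
Proof.
rewrite /between => h1 h2; have := tri m u v; have := tri v' m v; lia.
Qed.

(** Induction on the distance from v to w. Moving v one step towards w is harmless
if that step also approaches u. Otherwise either v is itself a median, or the
geodesic from v to w has a peak as seen from u next to v, and the quadrangle
condition replaces the peak by a neighbour of v closer to both u and w. *)
Lemma median_exists u v w : exists m, median_point u v w m.
Proof.
move: {2}(d v w) (erefl (d v w)) => n; elim/ltn_ind: n u v => n IH u v dvw.
case: n => [|n] in IH dvw.
  rewrite -(gdist_eq0 e_connected dvw); exists v.
  by rewrite /median_point /between !(gdist_refl e_connected) !addn0; split.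
have step v' : e v v' -> d v' w = n -> d u v = (d u v').+1 ->
    exists m, median_point u v w m.
  move=> vv' dv'w uvv'; have [m [m1 m2 m3]] := IH n (leqnn _) u v' dv'w.
  have b1 : between u v' v.
    have := gdist_edge e_connected (e_sym vv'); have := tri v' u v.
    by rewrite /between; lia.
  have b2 : between v v' w.
    have := gdist_edge e_connected vv'; have := tri v' v w.
    by rewrite /between; lia.
  exists m; split=> //; first exact: between_trans m1.
  by apply: betweenC; apply: between_trans (betweenC b2) (betweenC m2).
have [v' vv' dv'w] := gdist_first_edge e_connected dvw.
have [up|] := bipartite_step u vv'; last exact: step.
have [m [m1 m2 m3]] := IH n (leqnn _) u v' dv'w.
case E: (d m v') => [|k].
  move: E m3 => /(gdist_eq0 e_connected) ->; rewrite /between => m3.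
  exists v; rewrite /median_point /between !(gdist_refl e_connected) addn0; split=> //.
  have := dC u v; have := dC u v'; have := dC v v'; have := dC w v; have := dC w v'.
  have := tri v w u; have := gdist_edge e_connected vv'; lia.
have [x v'x mx] := gdist_last_edge e_sym e_connected E.
have dux : d u v' = (d u x).+1.
  move: m1; rewrite /between; have := tri m u x; have := bipartite_step u v'x; lia.
have dxw : d v' w = (d x w).+1.
  move: m2; rewrite /between (dC v' m); have := tri m x w; rewrite (dC x m).
  have := tri x v' w; have := gdist_edge e_connected v'x; lia.
have vx : v <> x by move=> ?; subst x; lia.
have [y [vy xy duy]] := quadrangle (e_sym vv') v'x vx up dux.
apply: (step y) => //.
have := tri x y w; have := gdist_edge e_connected (e_sym xy).
have := tri y v w; have := gdist_edge e_connected vy; lia.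
Qed.

(** The fallback value is never taken in the graphs of this section, by
[median_exists]; it keeps the operation independent of the hypotheses. *)
Definition med a b c : T :=
  if pselect (exists m, median_point a b c m) is left ex then sval (cid ex) else a.

Lemma medP a b c : median_point a b c (med a b c).
Proof.
rewrite /med; case: pselect => [ex|none]; first exact: svalP (cid ex).
by case: (none (median_exists a b c)).
Qed.

Lemma side_med u v a b c : e u v ->
  side u v (med a b c) = maj (side u v a) (side u v b) (side u v c).
Proof. by move=> uv; apply: side_median_point => //; apply: medP. Qed.

Lemma medC12 a b c : med a b c = med b a c.
Proof.
apply: (median_point_uniq (medP a b c)); have [h1 h2 h3] := medP b a c.
by split; apply: betweenC.
Qed.

Lemma medC23 a b c : med a b c = med a c b.
Proof.
apply: (median_point_uniq (medP a b c)); have [h1 h2 h3] := medP a c b.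
by split; apply: betweenC.
Qed.

Lemma med_between a b c : between a c b -> med a b c = c.
Proof.
move=> acb; apply: (median_point_uniq (medP a b c)).
by split=> //; rewrite /between (gdist_refl e_connected) ?addn0.
Qed.

(** A wall between the two medians separates x from x', hence is the wall of the
edge x x'; a geodesic of length two would cross that wall twice. *)
Lemma med_edge x x' y z : e x x' -> d (med x y z) (med x' y z) <= 1.
Proof.
move=> xx'; set p := med x y z; set q := med x' y z.
have cross s t : e s t -> side s t p -> ~~ side s t q -> side s t =1 side x x' \/ side s t =1 side x' x.
  move=> st; rewrite !side_med //.
  case hx: (side s t x); case hx': (side s t x') => //.
  - by case: (side s t y) (side s t z) => -[].
  - by left; apply: side_crossing => //; rewrite hx'.
  - by right; apply: side_crossing => //; [exact: e_sym|rewrite hx].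
  - by case: (side s t y) (side s t z) => -[].
case E: (d p q) => [|[|k]] //; exfalso.
have [s ps sq] := gdist_first_edge e_connected E.
have [t st tq] := gdist_first_edge e_connected sq.
have hp : side p s p by exact: side_l.
have hq : ~~ side p s q by rewrite /side (dC q p) (dC q s); lia.
have hp' : side s t p.
  rewrite /side; have := tri t p q; have := gdist_edge e_connected ps; have := bipartite p st; lia.
have hq' : ~~ side s t q by rewrite /side (dC q s) (dC q t); lia.
(* Both edges cross the wall of x x', in the same direction. *)
have same : side p s =1 side s t.
  have [h1|h1] := cross _ _ ps hp hq; have [h2|h2] := cross _ _ st hp' hq';
    move=> w; rewrite h1 h2 //; exfalso.
    by move: hp hp'; rewrite h1 h2 (sideN _ xx') => ->.
  by move: hp hp'; rewrite h1 h2 (sideN _ xx') => /negbTE ->.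
by have := side_r ps; rewrite same side_l.
Qed.

Lemma med_lipschitz1 x x' y z : d (med x y z) (med x' y z) <= d x x'.
Proof.
move: {2}(d x x') (erefl (d x x')) => k; elim: k x => [|k IH] x E.
  by rewrite E (gdist_eq0 e_connected E) (gdist_refl e_connected).
have [t xt tx'] := gdist_first_edge e_connected E.
have := IH t tx'; have := med_edge y z xt.
have := tri (med t y z) (med x y z) (med x' y z); lia.
Qed.

Lemma med_lipschitz x x' y y' z z' :
  d (med x y z) (med x' y' z') <= d x x' + d y y' + d z z'.
Proof.
have h1 := med_lipschitz1 x x' y z.
have h2 := med_lipschitz1 y y' x' z.
have h3 := med_lipschitz1 z z' x' y'.
rewrite -(medC12 x') -(medC12 x') in h2.
rewrite !(medC12 _ x') (medC23 x') (medC23 x' _ y') in h3.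
have := tri (med x' y z) (med x y z) (med x' y' z').
have := tri (med x' y' z) (med x' y z) (med x' y' z'); lia.
Qed.

End MedianGraph.

(** * Squares and three-cubes of a cube complex *)

Definition toggle n (b : {ffun 'I_n -> bool}) (i : 'I_n) : {ffun 'I_n -> bool} :=
  [ffun j => b j (+) (j == i)].

Section FaceMap.
Variables (k n : nat) (s : 'I_k -> 'I_n) (b : {ffun 'I_n -> bool}).

Lemma face_map_off x j : (forall i, s i != j) -> face_map s b x j = b j.
Proof.
move=> off; rewrite ffunE; case: existsP => [[i /andP[/eqP sij]]|_]; last by rewrite addbF.
by have := off i; rewrite sij eqxx.
Qed.

Hypothesis s_inj : injective s.

Lemma face_map_at x i : face_map s b x (s i) = b (s i) (+) x i.
Proof.
rewrite ffunE; congr (_ (+) _); apply/existsP/idP => [[i' /andP[/eqP /s_inj ->]]//|xi].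
by exists i; rewrite eqxx.
Qed.

(** Face maps are compatible with every Boolean operation that commutes with
translations, such as the majority and the sum of three arguments. *)
Lemma face_map_pointwise (F : bool -> bool -> bool -> bool)
    (x y z : {ffun 'I_k -> bool}) :
  F false false false = false ->
  (forall c u v w, F (c (+) u) (c (+) v) (c (+) w) = c (+) F u v w) ->
  face_map s b [ffun i => F (x i) (y i) (z i)] =
  [ffun j => F (face_map s b x j) (face_map s b y j) (face_map s b z j)].
Proof.
move=> F0 FD; apply/ffunP => j; rewrite [RHS]ffunE.
case: (pselect (exists i, s i = j)) => [[i <-]|none].
  by rewrite !face_map_at FD [in LHS]ffunE.
have off i : s i != j by apply/eqP => sij; apply: none; exists i.
by rewrite !face_map_off //; have := FD (b j) false false false; rewrite F0 !addbF.
Qed.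

Lemma face_map_toggle x i : face_map s b (toggle x i) = toggle (face_map s b x) (s i).
Proof.
apply/ffunP => j; rewrite [RHS]ffunE.
case: (pselect (exists i, s i = j)) => [[i' <-]|none].
  by rewrite !face_map_at ffunE (inj_eq s_inj) addbA.
have off i' : s i' != j by apply/eqP => sij; apply: none; exists i'.
by rewrite !face_map_off // eq_sym (negbTE (off i)) addbF.
Qed.

End FaceMap.

Section Squares.
Variable X : cubeComplex.
Implicit Types v z a b c x y p q r : X.

Lemma cube_edge n (f : {ffun 'I_n -> bool} -> X) (b : {ffun 'I_n -> bool}) i :
  cube f -> adjacent (f b) (f (toggle b i)).
Proof.
move=> cf; have s_inj : injective (fun _ : 'I_1 => i) by move=> j k _; rewrite !ord1.
exists (f \o face_map (fun _ : 'I_1 => i) b); split; first exact: cube_face.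
  by congr f; apply/ffunP => j; rewrite !ffunE; case: existsP => [[k]|_]; rewrite ?ffunE ?andbF ?addbF.
congr f; apply/ffunP => j; rewrite !ffunE; congr (_ (+) _); apply/existsP/eqP => [[k /andP[/eqP ->]]//|->].
by exists ord0; rewrite ffunE eqxx.
Qed.

Lemma adjacent_sym x y : adjacent x y -> adjacent y x.
Proof.
move=> [f [cf <- <-]].
have := cube_edge [ffun=> true] ord0 cf; rewrite (_ : toggle _ _ = [ffun=> false]) //.
by apply/ffunP => i; rewrite !ffunE ord1.
Qed.

(** The vertices are listed in cyclic order, starting at the origin of the
parametrization; [square_flip] and [square_rot] give the other parametrizations. *)
Definition square z a x b := exists f : {ffun 'I_2 -> bool} -> X,
  [/\ cube f, f (square_corner false false) = z, f (square_corner true false) = a,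
      f (square_corner true true) = x & f (square_corner false true) = b].

Let i0 : 'I_2 := ord0.
Let i1 : 'I_2 := ord_max.

Lemma toggle_square_corner u w :
  toggle (square_corner u w) i0 = square_corner (~~ u) w /\
  toggle (square_corner u w) i1 = square_corner u (~~ w).
Proof. by split; apply/ffunP => -[[|[|//]] p]; rewrite !ffunE /= ?addbT ?addbF. Qed.

Lemma cube_square n (f : {ffun 'I_n -> bool} -> X)
    (b : {ffun 'I_n -> bool}) i j : cube f -> i != j ->
  square (f b) (f (toggle b i)) (f (toggle (toggle b i) j)) (f (toggle b j)).
Proof.
move=> cf ij; pose s (k : 'I_2) := if k == ord0 then i else j.
have s_inj : injective s.
  by move=> [[|[|//]] p] [[|[|//]] q] //= E; apply: val_inj => //=;
    move: ij; rewrite /s /= in E; rewrite E eqxx.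
have c0 : face_map s b (square_corner false false) = b.
  apply/ffunP => k; rewrite ffunE; case: existsP => [[l]|_]; last by rewrite addbF.
  by rewrite ffunE; case: (l == ord0); rewrite andbF.
have e10 : square_corner true false = toggle (square_corner false false) i0.
  by rewrite (toggle_square_corner _ _).1.
have e01 : square_corner false true = toggle (square_corner false false) i1.
  by rewrite (toggle_square_corner _ _).2.
have e11 : square_corner true true = toggle (square_corner true false) i1.
  by rewrite (toggle_square_corner _ _).2.
exists (f \o face_map s b); split; first exact: cube_face.
- by rewrite /= c0.
- by rewrite /= e10 face_map_toggle // c0.
- by rewrite /= e11 face_map_toggle // e10 face_map_toggle // c0.
- by rewrite /= e01 face_map_toggle // c0.
Qed.

Lemma square_flip z a x b : square z a x b -> square z b x a.
Proof.
move=> [f [cf <- <- <- <-]].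
have := @cube_square _ f (square_corner false false) i1 i0 cf isT.
by rewrite !(toggle_square_corner _ _).1 !(toggle_square_corner _ _).2 (toggle_square_corner _ _).1.
Qed.

Lemma square_rot z a x b : square z a x b -> square a x b z.
Proof.
move=> [f [cf <- <- <- <-]].
have := @cube_square _ f (square_corner true false) i1 i0 cf isT.
by rewrite !(toggle_square_corner _ _).1 !(toggle_square_corner _ _).2 (toggle_square_corner _ _).1.
Qed.

Lemma square_adjacent z a x b : square z a x b -> adjacent z a.
Proof.
move=> [f [cf <- <- _ _]].
by have := cube_edge (square_corner false false) i0 cf; rewrite (toggle_square_corner _ _).1.
Qed.

Lemma square_neq z a x b : square z a x b -> z <> x.
Proof.
by move=> [f [/cube_inj inj <- _ <- _]] /inj /ffunP /(_ i0); rewrite !ffunE.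
Qed.

(** The common face of the two squares contains three corners. The fourth corner
is the sum of these three, and face maps preserve such sums. *)
Lemma square_uniq z a x b b' : square z a x b -> square z a x b' -> b = b'.
Proof.
move=> [f [cf f00 f10 f11 f01]] [g [cg g00 g10 g11 g01]].
have [|k [s [u [t [w [s_inj t_inj agree meet]]]]]] := cube_meet cf cg.
  by exists (square_corner false false), (square_corner false false); rewrite f00.
have [|y0 [fy0 gy0]] := meet (square_corner false false) (square_corner false false).
  by rewrite f00.
have [|y1 [fy1 gy1]] := meet (square_corner true false) (square_corner true false).
  by rewrite f10.
have [|y2 [fy2 gy2]] := meet (square_corner true true) (square_corner true true).
  by rewrite f11.
have x01 : square_corner false true = [ffun i => square_corner false false i (+)
    square_corner true false i (+) square_corner true true i].
  by apply/ffunP => i; rewrite !ffunE; case: ifP.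
have FD (c p q r : bool) : (c (+) p) (+) (c (+) q) (+) (c (+) r) = c (+) (p (+) q (+) r).
  by case: c p q r => -[] [] [].
pose F (p q r : bool) := p (+) q (+) r.
have eqf := @face_map_pointwise _ _ s u s_inj F y0 y1 y2 erefl FD.
have eqg := @face_map_pointwise _ _ t w t_inj F y0 y1 y2 erefl FD.
(* The parameter of the fourth corner is the sum of the three known ones. *)
have fx : square_corner false true = face_map s u [ffun i => F (y0 i) (y1 i) (y2 i)].
  by rewrite eqf -fy0 -fy1 -fy2 {1}x01.
have gx : square_corner false true = face_map t w [ffun i => F (y0 i) (y1 i) (y2 i)].
  by rewrite eqg -gy0 -gy1 -gy2 {1}x01.
by rewrite -f01 -g01 {1}fx gx; apply: agree.
Qed.

Lemma square_uniq_opp z a x x' b : square z a x b -> square z a x' b -> x = x'.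
Proof.
move=> /square_rot/square_rot/square_rot s1 /square_rot/square_rot/square_rot s2.
exact: square_uniq s1 s2.
Qed.

Hypothesis flagX : forall v : X, flag_link v.

Lemma link_simplex1 v a : adjacent v a -> link_simplex v (tnth [tuple a]).
Proof.
move=> [f [cf f0 f1]]; exists f; split=> // i; rewrite (tnth_nth a) /= ord1 /= -f1.
by congr f; apply/ffunP => j; rewrite !ffunE ord1.
Qed.

Lemma link_simplex2 v a p b : square v a p b -> link_simplex v (tnth [tuple a; b]).
Proof.
move=> [f [cf f00 f10 _ f01]]; exists f; split=> //.
  by rewrite -f00; congr f; apply/ffunP => i; rewrite !ffunE; case: ifP.
by case=> -[|[|//]] p'; rewrite (tnth_nth a) /= -?f10 -?f01; congr f;
  apply/ffunP => -[[|[|//]] q]; rewrite !ffunE.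
Qed.

(** The flag condition for triangles: three squares around v that pairwise share
an edge are faces of a cube, and y is the corner of that cube opposite to v. *)
Lemma three_squares v a b c p q r :
  square v a p b -> square v b q c -> square v a r c ->
  exists y, [/\ square a p y r, square b p y q & square c q y r].
Proof.
move=> sab sbc sac; pose u : 'I_3 -> X := tnth [tuple a; b; c].
have [i | i j |f [cf f0 fu]] := @flagX v 3 u.
- apply: link_simplex1.
  have [va vb vc] : [/\ adjacent v a, adjacent v b & adjacent v c].
    by split; [exact: square_adjacent sab|exact: square_adjacent sbc|
      exact: square_adjacent (square_flip sbc)].
  by case: i => -[|[|[|//]]] p'; rewrite /u (tnth_nth a).
- have sba := square_flip sab; have scb := square_flip sbc; have sca := square_flip sac.
  by case: i j => -[|[|[|//]]] p1 [] [|[|[|//]]] p2 // _; rewrite /u !(tnth_nth a) /=;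
    apply: link_simplex2; eassumption.
pose o : {ffun 'I_3 -> bool} := [ffun=> false].
pose j0 : 'I_3 := ord0; pose j1 : 'I_3 := Ordinal (erefl : 1 < 3); pose j2 : 'I_3 := ord_max.
have to i : toggle o i = [ffun j => j == i] by apply/ffunP => j; rewrite !ffunE.
have fa : f (toggle o j0) = a by rewrite to fu /u (tnth_nth a).
have fb : f (toggle o j1) = b by rewrite to fu /u (tnth_nth a).
have fc : f (toggle o j2) = c by rewrite to fu /u (tnth_nth a).
have togC (w : {ffun 'I_3 -> bool}) i j : toggle (toggle w i) j = toggle (toggle w j) i.
  by apply/ffunP => k; rewrite !ffunE addbAC.
have sq01 := @cube_square _ f o j0 j1 cf isT; rewrite fa fb f0 in sq01.
have sq12 := @cube_square _ f o j1 j2 cf isT; rewrite fc fb f0 in sq12.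
have sq02 := @cube_square _ f o j0 j2 cf isT; rewrite fa fc f0 in sq02.
have fp := square_uniq_opp sq01 sab; have fq := square_uniq_opp sq12 sbc.
have fr := square_uniq_opp sq02 sac.
exists (f (toggle (toggle (toggle o j0) j1) j2)).
have A := @cube_square _ f (toggle o j0) j1 j2 cf isT; rewrite fa fp fr in A.
have B := @cube_square _ f (toggle o j1) j0 j2 cf isT.
rewrite fb fq !(togC o j1 j0) fp in B.
have C := @cube_square _ f (toggle o j2) j0 j1 cf isT.
rewrite fc !(togC o j2) fr fq (togC _ j2) in C.
by split=> //; apply: square_flip.
Qed.

End Squares.

(** * Square flips and reduced paths *)

(** Finds a square among the hypotheses up to the eight symmetries of its
boundary. *)
Ltac dihedral := match goal with
  H : square ?z ?a ?x ?b |- _ => solve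
    [ exact H | exact (square_rot H) | exact (square_rot (square_rot H))
    | exact (square_rot (square_rot (square_rot H))) | exact (square_flip H)
    | exact (square_flip (square_rot H)) | exact (square_flip (square_rot (square_rot H)))
    | exact (square_flip (square_rot (square_rot (square_rot H))))] end.

Section Flips.
Variable X : cubeComplex.
Hypothesis flagX : forall v : X, flag_link v.
Implicit Types s t r q l : seq X.

(** Paths are lists of vertices read from their last vertex back to their origin, so
that extending a path is consing. A flip replaces a corner of a square by the
opposite corner. *)
Inductive flips : seq X -> seq X -> Prop :=
| flips_refl s : flips s s
| flips_head z a x b s : square z a x b -> flips [:: z, a, x & s] [:: z, b, x & s]
| flips_cons z s t : flips s t -> flips (z :: s) (z :: t)
| flips_trans s t r : flips s t -> flips t r -> flips s r.

Lemma flips_sym s t : flips s t -> flips t s.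
Proof.
elim=> [{}s|z a x b {}s sq|z {}s {}t _ st|{}s {}t r _ st _ tr].
- exact: flips_refl.
- exact/flips_head/square_flip.
- exact: flips_cons.
- exact: flips_trans st.
Qed.

Lemma flips_size s t : flips s t -> size s = size t.
Proof. by elim=> //= [z {}s {}t _ ->|{}s {}t r _ -> _ ->]. Qed.

Lemma flips_hd x0 s t : flips s t -> head x0 s = head x0 t.
Proof. by elim=> //= {}s {}t r _ -> _ ->. Qed.

Lemma flips_hd_eq a b s t : flips (a :: s) (b :: t) -> a = b.
Proof. by move=> /(flips_hd a). Qed.

Lemma flips_nil s : flips s [::] -> s = [::].
Proof. by move=> /flips_size /size0nil. Qed.

(** The two ways in which the tails of flip-equivalent paths ending at z can be
related: they are equivalent, or they reach z along the two sides of one square.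
The square is what survives of an arbitrarily long chain of flips at the last
corner. *)
Definition linked z s t := flips s t \/ exists a b x r,
  [/\ flips s [:: a, x & r], flips t [:: b, x & r] & square z a x b].

Lemma linked_sym z s t : linked z s t -> linked z t s.
Proof.
move=> [st|[a [b [x [r [sa tb sq]]]]]]; first by left; apply: flips_sym.
by right; exists b, a, x, r; split=> //; apply: square_flip.
Qed.

Lemma linked_flips z s t r : flips s t -> linked z t r -> linked z s r.
Proof.
move=> st [tr|[a [b [x [l [ta rb sq]]]]]]; first by left; apply: flips_trans tr.
by right; exists a, b, x, l; split=> //; apply: flips_trans ta.
Qed.

(** Cancellation. Chaining the two alternatives of [linked] meets two squares
that share the edge from b to z; by induction the sides at b also span a square
(or coincide), and the cube on these three squares provides a
direct square, so that b can be skipped. *)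
Lemma flips_tail z z' s t : flips (z :: s) (z' :: t) -> linked z s t.
Proof.
have [n] := ubnP (size s); elim: n => // n IH in z z' s t *; rewrite ltnS => sn.
move: {1 3}(z :: s) {1 3}(z' :: t) (erefl (z :: s)) (erefl (z' :: t)) => l l' El El' ll'.
move: El El'.
elim: ll' z z' s t sn => {l l'}.
- by move=> l z z' s t _ -> [_ ->]; left; apply: flips_refl.
- move=> w a x b l sq z z' s t _ [<- <-] [_ <-]; right.
  by exists a, b, x, l; split=> //; apply: flips_refl.
- by move=> w l l' ll' _ z z' s t _ [_ <-] [_ <-]; left.
move=> l1 l2 l3 f12 h12 f23 h23 z z' s t sn E1 E3.
case: l2 f12 h12 f23 h23 => [|z2 w] f12 h12 f23 h23.
  by have := flips_size f12; rewrite E1.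
have szw : size w <= n by have := flips_size f12; rewrite E1 => -[<-].
have Ez : z2 = z by rewrite E1 in f12; rewrite (flips_hd_eq f12).
have {h12} h12 := h12 z z2 s w sn E1 erefl.
have {h23} := h23 z2 z' w t szw erefl E3; rewrite Ez => h23 {Ez f12 f23 E1 E3 l1 l3 szw}.
case: h12 => [sw|[a [b [x [r [sa wb sq]]]]]]; first exact: linked_flips h23.
case: h23 => [wt|[b' [c [x' [r' [wb' tc sq']]]]]].
  by apply: linked_sym; apply: linked_flips (flips_sym wt) _; right;
     exists b, a, x, r; split=> //; apply: square_flip.
have bb := flips_trans (flips_sym wb) wb'; have E := flips_hd_eq bb; subst b'.
have szr : size (x :: r) < n by have := flips_size sa => /= <-.
case: (IH _ _ _ _ szr bb) => [xx|[x1 [x2 [y0 [p [xx1 xx2 sqb]]]]]].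
  have E := flips_hd_eq xx; subst x'.
  (* The squares z a x b and z c x b share two edges. *)
  have E : a = c.
    by apply: (@square_uniq _ x b z); dihedral.
  left; subst c; apply: flips_trans sa _; apply: flips_trans (flips_sym tc).
  exact: flips_cons.
have E := flips_hd_eq xx1; subst x1; have E := flips_hd_eq xx2; subst x2.
have [y [sy1 sy2 sy3]] : exists y, [/\ square x y0 y a, square x' y0 y c & square z c y a].
  by apply: three_squares sqb _ _ => //; dihedral.
right; exists a, c, y, (y0 :: p); split; last by dihedral.
- apply: flips_trans sa _; apply: flips_trans (flips_cons _ xx1) _.
  by apply: flips_head; dihedral.
- apply: flips_trans tc _; apply: flips_trans (flips_cons _ xx2) _.
  by apply: flips_head; dihedral.
Qed.

Definition reduced s := forall p x y q, ~ flips s (p ++ [:: x, y, x & q]).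

Lemma reduced_flips s t : flips s t -> reduced s -> reduced t.
Proof. by move=> st rs p x y q tp; apply: (rs p x y q); apply: flips_trans tp. Qed.

Lemma reduced_tail z s : reduced (z :: s) -> reduced s.
Proof. by move=> rs p x y q sp; apply: (rs (z :: p) x y q); apply: flips_cons. Qed.

(** A path w z s that contains a backtrack after flips must be able to cancel its last
edge. By cancellation such a backtrack gives a square at w z; walking around that
square moves the problem to a shorter path or flips w into s. *)
Lemma reduced_append w z s : reduced (z :: s) ->
  (forall r, ~ flips (z :: s) [:: z, w & r]) -> reduced [:: w, z & s].
Proof.
have [n] := ubnP (size s); elim: n => // n IH in w z s *; rewrite ltnS => sn.
move=> rs nd [|w' p] x y q /= fl; have E := flips_hd_eq fl; subst.
  case: (flips_tail fl) => [zs|[a [b [x0 [r [za yb sq]]]]]].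
    by have E := flips_hd_eq zs; subst; apply: (nd q).
  have E := flips_hd_eq za; subst; have E := flips_hd_eq yb; subst.
  case: (flips_tail yb) => [xx|[a' [b' [x1 [r1 [wa xb sq1]]]]]].
    by have E := flips_hd_eq xx; subst; case: (square_neq sq).
  have E := flips_hd_eq wa; subst; have E := flips_hd_eq xb; subst.
  have E := square_uniq_opp sq1 (square_rot (square_rot (square_rot sq))).
  by subst; apply: (rs [::] _ _ r1); apply: flips_trans za (flips_cons _ xb).
set l := p ++ _ in fl.
case: (flips_tail fl) => [zs|[a [t [x0 [r [za lt sq]]]]]]; first exact: (rs p x y q).
have E := flips_hd_eq za; subst.
have szr : size r < n by have := flips_size za => /= -[E]; lia.
have rx : reduced (x0 :: r) by apply: reduced_tail (reduced_flips za rs).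
case: (pselect (exists rho, flips (x0 :: r) [:: x0, t & rho])) => [[rho xr]|none].
  apply: (nd (t :: rho)); apply: flips_trans za _; apply: flips_trans (flips_cons _ xr) _.
  by apply: flips_head; dihedral.
by apply: (IH t x0 r szr rx _ p x y q (flips_sym lt)) => rho xr; apply: none; exists rho.
Qed.

(** Appending a vertex w to a path in normal form: if the path can be flipped so
that its last edge comes from w, that edge is removed. The default in [head] only
matters for the empty path. *)
Definition step s w : seq X :=
  if pselect (exists r, flips s [:: head w s, w & r]) is left ex then w :: sval (cid ex)
  else w :: s.

Lemma step_down z s w r : flips (z :: s) [:: z, w & r] -> flips (step (z :: s) w) (w :: r).
Proof.
move=> sr; rewrite /step; case: pselect => [ex|none]; last by case: none; exists r.
case: (cid ex) => r' /= sr'.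
have /flips_tail[//|[a [b [x [l [wa wb sq]]]]]] := flips_trans (flips_sym sr') sr.
have E := flips_hd_eq wa; subst; have E := flips_hd_eq wb; subst.
by case: (square_neq (square_rot sq)).
Qed.

Lemma step_up z s w : (forall r, ~ flips (z :: s) [:: z, w & r]) ->
  step (z :: s) w = [:: w, z & s].
Proof. by move=> none; rewrite /step; case: pselect => // ex; exfalso; case: ex => r /none. Qed.

Variant step_spec z s w : seq X -> Prop :=
| StepDown r of flips (z :: s) [:: z, w & r] : step_spec z s w (w :: r)
| StepUp of (forall r, ~ flips (z :: s) [:: z, w & r]) : step_spec z s w [:: w, z & s].

Lemma stepP z s w : step_spec z s w (step (z :: s) w).
Proof.
rewrite /step; case: pselect => [ex|none]; first by left; apply: (svalP (cid ex)).
by right=> r sr; apply: none; exists r.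
Qed.

Lemma step_nil w : step [::] w = [:: w].
Proof. by rewrite /step; case: pselect => // ex; exfalso; case: ex => r /flips_size. Qed.

Lemma step_flips s t w : flips s t -> flips (step s w) (step t w).
Proof.
case: s => [/flips_sym/flips_nil ->|z s]; first exact: flips_refl.
case: t => [/flips_size //|z' t] st; have E := flips_hd_eq st; subst.
case: (stepP z' s w) => [r sr|none].
  by apply/flips_sym/step_down; apply: flips_trans (flips_sym st) _.
rewrite step_up; first exact: flips_cons.
by move=> r tr; apply: (none r); apply: flips_trans tr.
Qed.

Lemma step_reduced s w : reduced s -> reduced (step s w).
Proof.
case: s => [_|z s rs].
  by rewrite step_nil => -[|a [|b p]] x y q /flips_size.
case: (stepP z s w) => [r sr|none]; last exact: reduced_append.
exact: reduced_tail (reduced_flips sr rs).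
Qed.

Lemma step_backtrack x y s : reduced (x :: s) -> flips (step (step (x :: s) y) x) (x :: s).
Proof.
move=> rs; case: (stepP x s y) => [r sr|none]; last first.
  by apply: step_down; apply: flips_refl.
rewrite step_up; first exact: flips_sym.
move=> r' yr; apply: (rs [::] x y r'); exact: flips_trans sr (flips_cons _ yr).
Qed.

(** Together with [step_backtrack] this is the invariance of normal forms under the
elementary homotopies. Whether a or b is a possible predecessor of z decides
between three situations; if both are, u is their common predecessor. *)
Lemma step_square z s a u b : reduced (z :: s) -> square z a u b ->
  flips (step (step (z :: s) a) u) (step (step (z :: s) b) u).
Proof.
have down_up a' b' r : reduced (z :: s) -> square z a' u b' ->
    flips (z :: s) [:: z, a' & r] -> (forall r, ~ flips (z :: s) [:: z, b' & r]) ->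
    flips (step (a' :: r) u) (step [:: b', z & s] u).
  move=> rs sq sa nb; rewrite step_up.
    apply/flips_sym/step_down; apply: flips_trans (flips_cons _ sa) _.
    by apply: flips_head; dihedral.
  move=> r' ar; apply: (nb (u :: r')); apply: flips_trans sa _.
  apply: flips_trans (flips_cons _ ar) _.
  by apply: flips_head; dihedral.
have up a' b' : square z a' u b' -> (forall r, ~ flips (z :: s) [:: z, b' & r]) ->
    forall r, ~ flips [:: a', z & s] [:: a', u & r].
  move=> sq nb r /flips_tail[zu|[c [c' [x [l [zc uc sq']]]]]].
    by have E := flips_hd_eq zu; subst; case: (square_neq sq).
  have E := flips_hd_eq zc; subst; have E := flips_hd_eq uc; subst.
  have E : x = b' by apply: (@square_uniq _ c a' c'); dihedral.
  by subst; apply: (nb l).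
move=> rs sq; case: (stepP z s a) => [r sa|na]; case: (stepP z s b) => [r' sb|nb].
- have /flips_tail[ab|[c [c' [x [l [ac bc sq']]]]]] := flips_trans (flips_sym sa) sb.
    by have E := flips_hd_eq ab; subst; case: (square_neq (square_rot sq)).
  have E := flips_hd_eq ac; subst; have E := flips_hd_eq bc; subst.
  have E : x = u by apply: (@square_uniq _ c z c'); dihedral.
  subst; apply: flips_trans (step_down ac) _; exact: flips_sym (step_down bc).
- exact: down_up sq sa nb.
- by apply: flips_sym; apply: (down_up b a r' rs _ sb na); dihedral.
- have sq' := square_flip sq.
  rewrite (step_up (up _ _ sq nb)) (step_up (up _ _ sq' na)).
  by apply: flips_head; dihedral.
Qed.

End Flips.

(** * The 1-skeleton of a CAT(0) cube complex *)

Section NormalForm.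
Variable X : cubeComplex.
Hypothesis flagX : forall v : X, flag_link v.
Implicit Types s t r q l p : seq X.
Local Notation step := (@step X).
Local Notation d := (gdist (@adjacent X)).

Definition normal p : seq X := foldl step [::] p.

Lemma foldl_step_flips s t q : flips s t -> flips (foldl step s q) (foldl step t q).
Proof. by elim: q s t => //= w q IH s t st; apply/IH/step_flips. Qed.

Lemma foldl_step_reduced s q : reduced s -> reduced (foldl step s q).
Proof. by elim: q s => //= w q IH s rs; apply/IH/step_reduced. Qed.

Lemma reduced_nil : @reduced X [::].
Proof. by move=> [|a p] x y q /flips_size. Qed.

Lemma step_cons s w : exists r, step s w = w :: r.
Proof.
case: s => [|z s]; first by rewrite step_nil; exists [::].
by case: (stepP z s w) => [r _|_]; [exists r|exists (z :: s)].
Qed.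

Lemma homotopic_normal p q : homotopic p q -> flips (normal p) (normal q).
Proof.
elim=> {p q}.
- by move=> p; apply: flips_refl.
- by move=> p q _; apply: flips_sym.
- by move=> p q r _ pq _; apply: flips_trans.
- move=> p q x y _; rewrite /normal !foldl_cat; apply: foldl_step_flips => /=.
  have rs : reduced (foldl step [::] p) by apply/foldl_step_reduced/reduced_nil.
  have := @step_reduced X flagX _ x rs; have [r ->] := step_cons (foldl step [::] p) x.
  exact: step_backtrack.
- move=> p q f cf; rewrite /normal !foldl_cat; apply: foldl_step_flips => /=.
  set z := f (square_corner false false).
  have rs : reduced (foldl step [::] p) by apply/foldl_step_reduced/reduced_nil.
  have := @step_reduced X flagX _ z rs; have [r ->] := step_cons (foldl step [::] p) z.
  by move=> rz; apply: (step_square flagX) => //; exists f.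
Qed.

Lemma normal_reduced p : reduced (rev p) -> normal p = rev p.
Proof.
elim/last_ind: p => // p w IH; rewrite /normal foldl_rcons rev_rcons => rp.
have := IH (reduced_tail rp); rewrite /normal => ->.
case: (rev p) rp => [_|z s rs]; first exact: step_nil.
by rewrite step_up // => r sr; apply: (rs [::] w z r); apply: flips_cons.
Qed.

(** Each edge is cancelled on the way back, from the last one to the first. *)
Lemma foldl_step_loop x s q : reduced (x :: s) ->
  flips (foldl step (x :: s) (q ++ rev (belast x q))) (x :: s).
Proof.
elim: q x s => [|y q IH] x s rs /=; first exact: flips_refl.
rewrite rev_cons -rcons_cat foldl_rcons.
have rt := @step_reduced X flagX _ y rs; have [r E] := step_cons (x :: s) y.
rewrite E in rt *; apply: flips_trans (step_flips flagX x (IH _ _ rt)) _.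
by rewrite -E; apply: step_backtrack.
Qed.

Lemma edge_path_rev (x : X) p : edge_path (@adjacent X) x p ->
  edge_path (@adjacent X) (last x p) (rev (belast x p)).
Proof.
rewrite /edge_path rev_path; apply: sub_path => u v /asboolP uv.
by apply/asboolP/adjacent_sym.
Qed.

Lemma rev_consE (x : X) p : rev (x :: p) = last x p :: rev (belast x p).
Proof. by rewrite lastI rev_rcons. Qed.

Hypothesis scX : simply_connected X.

Lemma loops_trivial (o : X) c :
  edge_path (@adjacent X) o c -> last o c = o -> homotopic (o :: c) [:: o].
Proof. by have [? ? ?] := scX; eauto. Qed.

Lemma connectedX : graph_connected (@adjacent X).
Proof. by have [? ? ?] := scX; eauto. Qed.

(** Run the normal form along t, then back along s and again forth along s. The
first two pieces form a loop, which is trivial, and the last two cancel. *)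
Lemma reduced_paths_flip z s t : edge_path (@adjacent X) z s ->
  edge_path (@adjacent X) z t -> last z s = last z t ->
  reduced (z :: s) -> reduced (z :: t) -> flips (z :: s) (z :: t).
Proof.
move=> zs zt st rs rt.
have rsE := rev_consE z s; have rtE := rev_consE z t.
set o := last z s in rsE st zs; rewrite -st in rtE.
set p := rev (belast z s) in rsE; set q := rev (belast z t) in rtE.
have op : edge_path (@adjacent X) o p by apply: edge_path_rev.
have lp : last o p = z by rewrite -(last_cons z) -rsE rev_cons last_rcons.
have lq : last o q = z by rewrite -(last_cons z) -rtE rev_cons last_rcons.
have loop : edge_path (@adjacent X) o (q ++ rev (belast o p)).
  rewrite /edge_path cat_path; apply/andP; split.
    by move: (edge_path_rev zt); rewrite -st.
  by rewrite lq -{1}lp; apply: edge_path_rev.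
have bp : z :: rev (belast o p) = z :: s.
  by rewrite -{1}lp -rev_consE -rsE revK.
case: bp => bp.
have ll : last o (q ++ rev (belast o p)) = o by rewrite last_cat lq bp.
have := homotopic_normal (loops_trivial loop ll); rewrite bp => /(foldl_step_flips p) fl.
have nq : normal (o :: q) = z :: t by rewrite normal_reduced -rtE ?revK // rtE.
have np : normal (o :: p) = z :: s by rewrite normal_reduced -rsE ?revK // rsE.
move: fl; rewrite -[foldl step (normal [:: o]) p]/(normal (o :: p)) np.
rewrite /normal -cat_cons foldl_cat -foldl_cat -[foldl step [::] _]/(normal (o :: q)) nq.
by move=> fl; apply: flips_trans (flips_sym fl) _; apply: foldl_step_loop.
Qed.

Lemma flips_path s t : flips s t -> forall z s', s = z :: s' ->
  edge_path (@adjacent X) z s' ->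
  exists t', [/\ t = z :: t', edge_path (@adjacent X) z t' & last z t' = last z s'].
Proof.
rewrite /edge_path; elim=> {s t}.
- by move=> s z s' -> zs'; exists s'.
- move=> w a x b s sq z s' [<- <-] /=; case/and3P=> _ _ xs; exists [:: b, x & s].
  split=> //=; apply/and3P; split=> //; apply/asboolP.
    exact: square_adjacent (square_flip sq).
  exact: square_adjacent (square_rot (square_flip sq)).
- move=> w [|y s] t st IH z s' [<- <-] ws; first by rewrite (flips_nil (flips_sym st)); exists [::].
  move: ws => /= /andP[wy ys]; have [t' [-> yt lt]] := IH _ _ erefl ys.
  by exists (y :: t') => /=; rewrite wy.
- move=> s t r _ IH1 _ IH2 z s' Es zs.
  have [t' [Et zt <-]] := IH1 _ _ Es zs; exact: IH2 Et zt.
Qed.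

Let dC := gdistC (@adjacent_sym X) connectedX.
Let tri := gdist_triangle connectedX.

(** Removing a backtrack from a path of minimal length would shorten it. *)
Lemma geodesic_reduced (z : X) s : edge_path (@adjacent X) z s ->
  size s = d z (last z s) -> reduced (z :: s).
Proof.
move=> zs ds p x y q fl; have [t [Et zt lt]] := flips_path fl erefl zs.
suff : walk (@adjacent X) (size s).-2 z (last z s).
  move/(gdist_le connectedX); have := flips_size fl.
  by rewrite size_cat /= -ds; lia.
have /= := flips_size fl; rewrite size_cat /= => sz.
case: p Et sz {fl} => [[-> Et]|w p [-> Et]] /= sz; move: zt lt; rewrite -Et.
  rewrite /edge_path /= => /and3P[_ _ zq] lt; exists q; split=> //; lia.
rewrite /edge_path cat_path /= => /and5P[zp px _ _ xq].
rewrite last_cat /= => lt; exists (p ++ x :: q).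
rewrite /edge_path cat_path /= zp px xq last_cat; split=> //.
by rewrite size_cat /=; lia.
Qed.

Lemma geodesics_flip (z o : X) s t :
  edge_path (@adjacent X) z s -> edge_path (@adjacent X) z t ->
  last z s = o -> last z t = o -> size s = d z o -> size t = d z o ->
  flips (z :: s) (z :: t).
Proof.
move=> zs zt so to ds dt; apply: reduced_paths_flip => //; first by rewrite to.
  by apply: geodesic_reduced => //; rewrite so.
by apply: geodesic_reduced => //; rewrite to.
Qed.

Lemma homotopic_odd p q : homotopic p q -> odd (size p) = odd (size q).
Proof.
elim=> {p q} // [p q r _ -> //|p q x y _|p q f _].
  by rewrite !size_cat /= !addnS /= negbK.
by rewrite !size_cat.
Qed.

(** Elementary homotopies preserve the parity of the length, so closed paths have
even length. *)
Lemma cat0_bipartite o x y : adjacent x y -> d o x != d o y.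
Proof.
move=> xy; apply/eqP => E.
have [p [op px sp]] := gdist_walk connectedX o x.
have [q [yq qo sq]] := gdist_walk connectedX y o.
have loop : edge_path (@adjacent X) o (p ++ y :: q).
  by rewrite /edge_path in op yq *; rewrite cat_path /= op px yq andbT; apply/asboolP.
have lo : last o (p ++ y :: q) = o by rewrite last_cat.
have := homotopic_odd (loops_trivial loop lo).
by rewrite /= size_cat /= sp sq (dC y o) -E addnS /= negbK oddD addbb.
Qed.

Lemma cat0_quadrangle o z a b : adjacent z a -> adjacent z b -> a <> b ->
  d o z = (d o a).+1 -> d o z = (d o b).+1 ->
  exists x, [/\ adjacent a x, adjacent b x & d o a = (d o x).+1].
Proof.
move=> za zb ab oa ob.
have [s [pa la sa]] := gdist_walk connectedX a o.
have [t [pb lb sb]] := gdist_walk connectedX b o.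
have /flips_tail[//||] : flips (z :: a :: s) (z :: b :: t).
  apply: (geodesics_flip (o := o)) => //=; first by apply/andP; split=> //; apply/asboolP.
  - by apply/andP; split=> //; apply/asboolP.
  - by rewrite sa (dC z) (dC a).
  - by rewrite sb (dC z) (dC b).
- by move/flips_hd_eq.
move=> [a' [b' [x [r [fa fb sq]]]]].
have E := flips_hd_eq fa; subst a'; have E := flips_hd_eq fb; subst b'.
exists x; split; [exact: square_adjacent (square_rot sq)| |].
  exact: square_adjacent (square_rot (square_flip sq)).
have [r' [[<-] /andP[/asboolP ax xr] lr]] := flips_path fa erefl pa.
have sr : size s = (size r).+1 by have := flips_size fa => -[].
have dx : d x o <= size r.
  by apply: (gdist_le connectedX); exists r; split=> //; rewrite -la -lr.
have := gdist_edge connectedX (adjacent_sym ax); have := tri x o a.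
rewrite (dC x o) in dx; rewrite (dC a o) in sa; lia.
Qed.

(** Both paths from z to x are geodesics because the graph is bipartite. *)
Lemma four_cycle_square (z a x b : X) : z <> x -> a <> b -> adjacent z a -> adjacent a x ->
  adjacent z b -> adjacent b x -> square z a x b.
Proof.
move=> zx ab za ax zb bx.
have dzx : d z x = 2.
  have := gdist_edge connectedX za; have := gdist_edge connectedX ax.
  have := tri a z x; have := cat0_bipartite z ax; have := cat0_bipartite z za.
  rewrite (gdist_refl connectedX).
  by case E: (d z x) => [|n]; [case: zx; apply: gdist_eq0 connectedX _ _ E|lia].
have /flips_tail[//||] : flips [:: z; a; x] [:: z; b; x].
- by apply: (geodesics_flip (o := x)); rewrite ?dzx // /edge_path /= andbT;
    apply/andP; split; apply/asboolP.
- by move/flips_hd_eq.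
move=> [a' [b' [x' [r [fa fb sq]]]]].
have E := flips_hd_eq fa; subst a'; have E := flips_hd_eq fb; subst b'.
suff -> : x = x' by [].
have [xr|[a' [b' [y [l [fx _ _]]]]]] := flips_tail flagX fa; first exact: flips_hd_eq xr.
by have := flips_size fx.
Qed.

Lemma cat0_no_K23 (z x a b c : X) : z <> x -> a <> b ->
  adjacent z a -> adjacent a x -> adjacent z b -> adjacent b x ->
  adjacent z c -> adjacent c x -> c = a \/ c = b.
Proof.
move=> zx ab za ax zb bx zc cx; case: (pselect (c = a)) => [|ca]; [by left|right].
apply: (@square_uniq _ z a x); apply: four_cycle_square => //; exact: not_eq_sym.
Qed.

End NormalForm.

(** * From discrete median algebras to CAT(0) cube complexes *)

Definition maj_ffun n (x y z : {ffun 'I_n -> bool}) : {ffun 'I_n -> bool} :=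
  [ffun i => maj (x i) (y i) (z i)].

Lemma maj_addb c p q r : maj (c (+) p) (c (+) q) (c (+) r) = c (+) maj p q r.
Proof. by case: c p q r => -[] [] []. Qed.

Lemma toggle_diff n (x : {ffun 'I_n -> bool}) i j : (toggle x i j != x j) = (j == i).
Proof. by rewrite ffunE; case: (j == i) (x j) => -[]. Qed.

Section MajHom.
Variables (n : nat) (g : {ffun 'I_n -> bool} -> bool).
Implicit Types b x : {ffun 'I_n -> bool}.
Hypothesis g_hom : forall x y z, g (maj_ffun x y z) = maj (g x) (g y) (g z).

Lemma cube_hom_sep b x i : x i != b i -> g (toggle b i) != g b -> g x != g b.
Proof.
move=> xi gi; apply: contra gi => /eqP gx.
have -> : toggle b i = maj_ffun b x (toggle b i).
  apply/ffunP => j; rewrite !ffunE; case: eqP => [->|_]; move: xi.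
    by case: (x i) (b i) => -[].
  by rewrite addbF; case: (b j) (x j) => -[].
by rewrite g_hom gx /maj; case: (g b) (g (toggle b i)) => -[].
Qed.

(** A homomorphism from the cube to the two-element algebra that distinguishes x from
b already distinguishes b from one of its neighbours towards x: for a closest
such x, differing from b in two coordinates, x would be the majority of x and two
points where g takes the value g b. *)
Lemma cube_hom_sepP b x : reflect (exists i, x i != b i /\ g (toggle b i) != g b) (g x != g b).
Proof.
apply: (iffP idP) => [|[i [xi gi]]]; last exact: cube_hom_sep gi.
have [k] := ubnP #|[set i | x i != b i]%SET|; elim: k => // k IH in x *; rewrite ltnS => xk gx.
have [i xi] : exists i, x i != b i.
  apply/existsP; apply: contraNT gx => /existsPn same; apply/eqP; congr g.
  by apply/ffunP => i; apply/eqP; have := same i; rewrite negbK.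
case: (boolP [exists j, (j != i) && (x j != b j)]) => [/existsP[j /andP[ji xj]]|]; last first.
  move=> /existsPn same; exists i; split=> //; move: gx; congr (_ != _); congr g.
  apply/ffunP => j; rewrite ffunE; case: eqP => [->|/eqP ji].
    by move: xi; case: (x i) (b i) => -[].
  by have := same j; rewrite ji /= negbK => /eqP ->; rewrite addbF.
have less l : x l != b l -> #|[set i0 | toggle x l i0 != b i0]%SET| < k.
  move=> xl; apply: leq_trans xk; apply: proper_card; apply/properP; split.
    apply/fintype.subsetP => i0; rewrite !inE ffunE.
    by case: (eqVneq i0 l) => [-> //|_]; rewrite addbF.
  by exists l; rewrite !inE // ffunE eqxx; move: xl; case: (x l) (b l) => -[].
have up l : x l != b l -> (exists i0, toggle x l i0 != b i0 /\ g (toggle b i0) != g b) ->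
    exists i0, x i0 != b i0 /\ g (toggle b i0) != g b.
  move=> xl [i0 [h1 h2]]; exists i0; split=> //.
  by move: h1; rewrite ffunE; case: (eqVneq i0 l) => [-> //|_]; rewrite addbF.
case: (boolP (g (toggle x i) != g b)) => [gi|]; first exact: (up i xi (IH _ (less i xi) gi)).
case: (boolP (g (toggle x j) != g b)) => [gj|]; first by move=> _; exact: (up j xj (IH _ (less j xj) gj)).
rewrite !negbK => /eqP gj /eqP gi; move: gx.
have -> : x = maj_ffun (toggle x i) (toggle x j) x.
  apply/ffunP => l; rewrite !ffunE; case: (eqVneq l i) => [->|_].
    by rewrite eq_sym (negbTE ji); case: (x i).
  by case: (x l) (l == j) => -[].
by rewrite g_hom gi gj; case: (g b) (g x) => -[].
Qed.

End MajHom.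

Section Cubulation.
Variables (M : Type) (m : M -> M -> M -> M).

Definition median_hom (h : M -> bool) := forall x y z, h (m x y z) = maj (h x) (h y) (h z).

Hypothesis separated : forall x y, (forall h, median_hom h -> h x = h y) -> x = y.

Ltac median_identity := apply: separated;
  let h := fresh "h" in let hh := fresh "hh" in
  intros h hh; rewrite ?hh /maj; repeat (match goal with |- context[h ?x] => case: (h x) end);
  done.

Lemma separating_hom x y : x <> y -> exists2 h, median_hom h & h x != h y.
Proof.
move=> xy; apply: contrapT => none; apply: xy; apply: separated => h hh.
by apply/eqP/negPn/negP => hxy; apply: none; exists h.
Qed.

Lemma m_id x y : m x x y = x. Proof. median_identity. Qed.
Lemma mC12 x y z : m x y z = m y x z. Proof. median_identity. Qed.
Lemma mC23 x y z : m x y z = m x z y. Proof. median_identity. Qed.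

Definition covers x y := x <> y /\ forall z, m x y z = x \/ m x y z = y.

Lemma covers_sym x y : covers x y -> covers y x.
Proof.
move=> [xy h]; split=> [yx|z]; first exact: xy.
by rewrite mC12; have [->|->] := h z; [right|left].
Qed.

(** The median of v, a and b lies in both edges and is different from v. *)
Lemma neighbour_uniq v a b h : median_hom h -> covers v a -> covers v b ->
  h a != h v -> h b != h v -> a = b.
Proof.
move=> hh [_ /(_ b) va] [_ /(_ a) vb] ha hb.
have hp : h (m v a b) != h v by rewrite hh; move: ha hb; case: (h v) (h a) (h b) => -[] [].
rewrite -mC23 in vb.
case: va => E; first by rewrite E eqxx in hp.
by case: vb => E2; [rewrite E2 eqxx in hp|rewrite -E E2].
Qed.

(** Being an edge only depends on the homomorphisms that separate the
two ends. *)
Lemma covers_parallel p q p' q' : covers p q ->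
  (forall h, median_hom h -> if h p == h q then h p' == h q' else (h p' == h p) && (h q' == h q)) ->
  covers p' q'.
Proof.
move=> [pq pqz] par; split=> [E|z].
  have [h hh hpq] := separating_hom pq; have := par h hh.
  by rewrite (negbTE hpq) E => /andP[/eqP E1 /eqP E2]; rewrite -E1 E2 eqxx in hpq.
case: (pqz z) => E; [left|right]; apply: separated => h hh;
  have := par h hh; have := congr1 h E; rewrite !hh;
  by case: (h p) (h q) (h p') (h q') (h z) => -[] [] [] [].
Qed.

(** The first condition alone would allow degenerate and subdivided cubes; together
the two conditions describe the embedded cubes with convex image. *)
Definition median_cube n (f : {ffun 'I_n -> bool} -> M) :=
  (forall x y z, f (maj_ffun x y z) = m (f x) (f y) (f z)) /\
  forall x i, covers (f x) (f (toggle x i)).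

Lemma median_cube_hom n (f : {ffun 'I_n -> bool} -> M) h : median_cube f ->
  median_hom h -> forall x y z, h (f (maj_ffun x y z)) = maj (h (f x)) (h (f y)) (h (f z)).
Proof. by move=> [fh _] hh x y z; rewrite fh hh. Qed.

Lemma median_cube_vertex (f : {ffun 'I_0 -> bool} -> M) : median_cube f.
Proof.
split=> [x y z|x []//].
have E (u v : {ffun 'I_0 -> bool}) : u = v by apply/ffunP => -[].
by rewrite (E y x) (E z x) m_id; congr f; apply: E.
Qed.

(** If f x = f y and x, y differ at i, then flipping x at i gives a majority of x, y
and itself, so the edge of f at x in direction i would be degenerate. *)
Lemma median_cube_inj n (f : {ffun 'I_n -> bool} -> M) : median_cube f -> injective f.
Proof.
move=> [fh fa] x y fxy; apply/ffunP => i; apply: contrapT => /eqP xy.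
case: (fa x i) => ne _; apply: ne.
have -> : toggle x i = maj_ffun x y (toggle x i).
  apply/ffunP => j; rewrite !ffunE; case: eqP => [->|_]; move: xy.
    by case: (x i) (y i) => -[].
  by rewrite addbF; case: (x j) (y j) => -[].
by rewrite fh -fxy m_id.
Qed.

Lemma median_cube_face k n (s : 'I_k -> 'I_n) (b : {ffun 'I_n -> bool})
    (f : {ffun 'I_n -> bool} -> M) :
  injective s -> median_cube f -> median_cube (f \o face_map s b).
Proof.
move=> s_inj [fh fa]; split=> [x y z|x i] /=; last by rewrite face_map_toggle.
rewrite -fh; congr f.
exact: (@face_map_pointwise _ _ s b s_inj maj x y z erefl maj_addb).
Qed.

Section Meet.
Variables (k n : nat) (f : {ffun 'I_k -> bool} -> M) (g : {ffun 'I_n -> bool} -> M).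
Hypotheses (cf : median_cube f) (cg : median_cube g).
Variables (u0 : {ffun 'I_k -> bool}) (w0 : {ffun 'I_n -> bool}).
Hypothesis fg0 : f u0 = g w0.

(** A homomorphism separating the edge of f at u0 in direction i separates f u = g w
from the common corner, hence separates an edge of g at w0; two edges at one vertex
separated by the same homomorphism are equal. *)
Lemma common_direction u w i : f u = g w -> u i != u0 i ->
  exists2 j, w j != w0 j & f (toggle u0 i) = g (toggle w0 j).
Proof.
move=> fgu ui; have cfi := cf.2 u0 i; have [ne _] := cfi.
have [h hh hne] := separating_hom ne; rewrite eq_sym in hne.
have := cube_hom_sep (median_cube_hom cf hh) ui hne.
rewrite fgu fg0 => /(cube_hom_sepP (median_cube_hom cg hh)) [j [wj hj]].
exists j => //; apply: (neighbour_uniq hh cfi) => //; rewrite fg0 //; exact: cg.2.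
Qed.

End Meet.

(** The common face is spanned at a common vertex by the edges that belong to
both cubes: a cube is determined by its edges at one corner. *)
Lemma median_cube_meet k n (f : {ffun 'I_k -> bool} -> M) (g : {ffun 'I_n -> bool} -> M) :
    median_cube f -> median_cube g -> (exists u w, f u = g w) ->
    exists l (s : 'I_l -> 'I_k) a (t : 'I_l -> 'I_n) b,
      [/\ injective s, injective t,
          f \o face_map s a =1 g \o face_map t b &
          forall u w, f u = g w ->
            exists x, u = face_map s a x /\ w = face_map t b x].
Proof.
move=> cf cg [u0 [w0 fg0]].
pose matched i j := `[< f (toggle u0 i) = g (toggle w0 j) >].
pose D := [set i | [exists j, matched i j]]%SET.
have Dj (i : 'I_#|D|) : exists j, matched (enum_val i) j.
  by have := enum_valP i; rewrite inE => /existsP.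
pose t i := xchoose (Dj i).
have tP i : f (toggle u0 (enum_val i)) = g (toggle w0 (t i)) by apply/asboolP/(xchooseP (Dj i)).
have toggle_inj l (b : {ffun 'I_l -> bool}) i j : toggle b i = toggle b j -> i = j.
  by move/ffunP/(_ i)/eqP; rewrite -[_ == _]negbK; move: (toggle_diff b j i) (toggle_diff b i i);
    rewrite eqxx !ffunE eqxx; case: (i =P j) => //; case: (b i).
have t_inj : injective t.
  move=> i j tij; apply: enum_val_inj; apply: (@toggle_inj _ u0); apply: (median_cube_inj cf).
  by rewrite !tP tij.
exists #|D|, (@enum_val _ _), u0, t, w0; split=> //; first exact: enum_val_inj.
  move=> x /=; apply: separated => h hh.
  suff : (h (f (face_map enum_val u0 x)) != h (f u0)) = (h (g (face_map t w0 x)) != h (g w0)).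
    by rewrite fg0; case: (h _) (h _) (h _) => -[] [].
  apply/(cube_hom_sepP (median_cube_hom cf hh))/(cube_hom_sepP (median_cube_hom cg hh)).
    move=> [i [xi hi]]; case: (pselect (exists l : 'I_#|D|, enum_val l = i)) => [[l El]|none].
      exists (t l); rewrite -tP El -fg0; split=> //.
      move: xi; rewrite -El face_map_at ?face_map_at //; last exact: enum_val_inj.
      by case: (x l) (u0 _) (w0 _) => -[] [].
    by move: xi; rewrite face_map_off ?eqxx // => l; apply/eqP => El; apply: none; exists l.
  move=> [i [xi hi]]; case: (pselect (exists l : 'I_#|D|, t l = i)) => [[l El]|none].
    exists (enum_val l); rewrite tP El fg0; split=> //.
    move: xi; rewrite -El face_map_at ?face_map_at //; last exact: enum_val_inj.
    by case: (x l) (u0 _) (w0 _) => -[] [].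
  by move: xi; rewrite face_map_off ?eqxx // => l; apply/eqP => El; apply: none; exists l.
move=> u w fgu; exists [ffun l => u (enum_val l) (+) u0 (enum_val l)]; split; apply/ffunP => i.
  case: (pselect (exists l : 'I_#|D|, enum_val l = i)) => [[l El]|none].
    rewrite -El face_map_at; last exact: enum_val_inj.
    by rewrite ffunE addbC addbK.
  rewrite face_map_off => [|l]; last by apply/eqP => El; apply: none; exists l.
  apply/eqP/negPn/negP => /(common_direction cf cg fg0 fgu)[j _ fj].
  have iD : i \in D by rewrite inE; apply/existsP; exists j; apply/asboolP.
  by apply: none; exists (enum_rank_in iD i); rewrite enum_rankK_in.
case: (pselect (exists l : 'I_#|D|, t l = i)) => [[l El]|none].
  rewrite -El face_map_at // ffunE.
  suff : (w (t l) != w0 (t l)) = (u (enum_val l) != u0 (enum_val l)).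
    by case: (w _) (w0 _) (u _) (u0 _) => -[] [] [].
  apply/idP/idP => [/(common_direction cg cf (esym fg0) (esym fgu))[j uj]|
                    /(common_direction cf cg fg0 fgu)[j wj]]; rewrite tP || rewrite -tP.
    by move=> /(median_cube_inj cf) /toggle_inj ->.
  by move=> /(median_cube_inj cg) /toggle_inj ->.
rewrite face_map_off => [|l]; last by apply/eqP => El; apply: none; exists l.
apply/eqP/negPn/negP => /(common_direction cg cf (esym fg0) (esym fgu))[j _ fj].
have jD : j \in D by rewrite inE; apply/existsP; exists i; apply/asboolP.
apply: none; exists (enum_rank_in jD j); apply: (@toggle_inj _ w0); apply: (median_cube_inj cg).
by rewrite -tP enum_rankK_in.
Qed.

Definition cubulation : cubeComplex := CubeComplex median_cube_vertex
  median_cube_inj median_cube_face median_cube_meet.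

Local Notation Y := cubulation.

Lemma adjacentE (x y : Y) : adjacent x y <-> covers x y.
Proof.
split=> [[f [[_ fa] <- <-]]|xy].
  suff <- : toggle [ffun=> false] (ord0 : 'I_1) = [ffun=> true] by apply: fa.
  by apply/ffunP => i; rewrite !ffunE ord1.
exists (fun u : {ffun 'I_1 -> bool} => if u ord0 then y else x); split; rewrite ?ffunE //.
split=> [u v w|u i].
  by rewrite ffunE; case: (u ord0) (v ord0) (w ord0) => -[] [] /=; median_identity.
by rewrite ffunE ord1 eqxx addbT; case: (u ord0) => //=; apply: covers_sym.
Qed.

Section Corner.
Variables (v : M) (n : nat) (u : 'I_n -> M).
Hypothesis edges : forall i, covers v (u i).
Hypothesis u_inj : injective u.
Hypothesis pair_join : forall i j, i != j -> exists p, forall h, median_hom h ->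
  (h p != h v) = (h (u i) != h v) || (h (u j) != h v).

(** Join of the u i, i in A, when v is regarded as the least element. If i and j are
two elements of A, the median of the joins over A minus i, over A minus j and over
{i, j} is the join over A. *)
Lemma corner_join (A : {set 'I_n}) : exists z, forall h, median_hom h ->
  (h z != h v) = [exists i, (i \in A) && (h (u i) != h v)].
Proof.
have [k] := ubnP #|A|; elim: k => // k IH in A *; rewrite ltnS => Ak.
case: (set_0Vmem A) => [->|[i iA]].
  exists v => h hh; rewrite eqxx; apply/esym/existsP => -[i]; by rewrite inE.
case: (set_0Vmem (A :\ i)%SET) => [A0|[j]].
  exists (u i) => h hh; apply/idP/existsP => [hi|[j /andP[jA hj]]].
    by exists i; rewrite iA.
  suff -> : i = j by [].
  by apply: contrapT => ij; move/finset.setP: A0 => /(_ j); rewrite !inE jA andbT => /negbFE/eqP/esym.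
rewrite !inE => /andP[ji jA].
have sz l : l \in A -> #|(A :\ l)%SET| < k by move=> lA; move: Ak; rewrite (cardsD1 l) lA.
have [z1 h1] := IH _ (sz i iA); have [z2 h2] := IH _ (sz j jA).
have [p hp] := pair_join ji.
exists (m z1 z2 p) => h hh.
have {h1 h2 hp} [h1 h2 hp] := And3 (h1 h hh) (h2 h hh) (hp h hh).
have -> : [exists l, (l \in A) && (h (u l) != h v)] =
    maj (h z1 != h v) (h z2 != h v) (h p != h v).
  rewrite h1 h2 hp; apply/existsP/idP => [[l /andP[lA hl]]|].
    case: (eqVneq l i) => [li|li].
      rewrite -li hl orbT; suff -> : [exists l0, (l0 \in (A :\ j)%SET) && (h (u l0) != h v)].
        by rewrite /maj !orbT.
      by apply/existsP; exists i; rewrite !inE eq_sym ji iA -li hl.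
    have -> : [exists l0, (l0 \in (A :\ i)%SET) && (h (u l0) != h v)].
      by apply/existsP; exists l; rewrite !inE li lA.
    case: (eqVneq l j) => [lj|lj]; first by rewrite -lj hl /maj /= !orbT.
    suff -> : [exists l0, (l0 \in (A :\ j)%SET) && (h (u l0) != h v)] by [].
    by apply/existsP; exists l; rewrite !inE lj lA.
  case: existsP => [[l]|_]; first by rewrite !inE => /andP[/andP[_ lA] hl] _; exists l; rewrite lA.
  case: existsP => [[l]|_]; first by rewrite !inE => /andP[/andP[_ lA] hl] _; exists l; rewrite lA.
  by rewrite /maj /= andbF.
by rewrite hh; case: (h z1) (h z2) (h p) (h v) => -[] [] [].
Qed.

Let f (x : {ffun 'I_n -> bool}) : M := sval (cid (corner_join [set i | x i]%SET)).

Let fE x h : median_hom h -> (h (f x) != h v) = [exists i, x i && (h (u i) != h v)].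
Proof.
move=> hh; rewrite (svalP (cid (corner_join [set i | x i]%SET)) h hh).
by apply: eq_existsb => i; rewrite inE.
Qed.

Let f_sep x h i : median_hom h -> h (u i) != h v -> (h (f x) != h v) = x i.
Proof.
move=> hh hi; rewrite fE //; apply/existsP/idP => [[j /andP[xj hj]]|xi]; last by exists i; rewrite xi.
suff -> : i = j by [].
by apply: u_inj; apply: (neighbour_uniq hh (edges i) (edges j)).
Qed.

Let f_const x h : median_hom h -> (forall i, h (u i) = h v) -> h (f x) = h v.
Proof.
move=> hh none; apply/eqP; rewrite -[_ == _]negbK fE //; apply/existsP => -[i].
by rewrite none eqxx andbF.
Qed.

(** The cube sends x to the join of the u i with x i true. Every homomorphism
separates v from at most one u i, so on this cube it is constant or a
coordinate, which gives both conditions on median cubes. *)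
Lemma cube_of_corner : exists g : {ffun 'I_n -> bool} -> M,
  [/\ median_cube g, g [ffun=> false] = v & forall i, g [ffun j => j == i] = u i].
Proof.
have cases (h : M -> bool) : (exists i, h (u i) != h v) \/ (forall i, h (u i) = h v).
  case: (pselect (exists i, h (u i) != h v)) => [|none]; [by left|right=> i].
  by apply/eqP/negPn/negP => hi; apply: none; exists i.
have eqb (a b c : bool) : (a != c) = (b != c) -> a = b by case: a b c => -[] [].
exists f; split.
- split=> [x y z|x i].
    apply: separated => h hh; rewrite hh; have [[i hi]|none] := cases h.
      have := f_sep x hh hi; have := f_sep y hh hi; have := f_sep z hh hi.
      have := f_sep (maj_ffun x y z) hh hi; rewrite ffunE.
      move=> E0 Ez Ey Ex; move: E0; rewrite -Ez -Ey -Ex.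
      by case: (h (f (maj_ffun x y z))) (h v) (h (f x)) (h (f y)) (h (f z)) => -[] [] [] [].
    by rewrite !f_const // /maj; case: (h v).
  (* Both cases below are this edge, taken in one of its two directions. *)
  have low : covers (f [ffun j => x j && (j != i)]) (f [ffun j => x j || (j == i)]).
    apply: covers_parallel (edges i) _ => h hh; case: eqVneq => hi.
      apply/eqP/(eqb _ _ (h v)); rewrite !fE //; apply: eq_existsb => j; rewrite !ffunE.
      by case: (eqVneq j i) => [->|_]; rewrite ?hi ?eqxx ?andbF ?andbT ?orbF.
    rewrite eq_sym in hi.
    have := f_sep [ffun j => x j && (j != i)] hh hi; have := f_sep [ffun j => x j || (j == i)] hh hi.
    rewrite !ffunE eqxx andbF orbT; move: hi.
    by case: (h _) (h _) (h _) (h _) => -[] [] [].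
  case xi: (x i).
    have -> : toggle x i = [ffun j => x j && (j != i)].
      by apply/ffunP => j; rewrite !ffunE; case: (eqVneq j i) => [->|_]; rewrite ?xi ?addbF ?andbT.
    have -> : f x = f [ffun j => x j || (j == i)]; last exact: covers_sym.
    by congr f; apply/ffunP => j; rewrite !ffunE; case: (eqVneq j i) => [->|_]; rewrite ?xi ?orbF.
  have -> : toggle x i = [ffun j => x j || (j == i)].
    by apply/ffunP => j; rewrite !ffunE; case: (eqVneq j i) => [->|_]; rewrite ?xi ?addbF ?orbF.
  have -> : f x = f [ffun j => x j && (j != i)]; last exact: low.
  by congr f; apply/ffunP => j; rewrite !ffunE; case: (eqVneq j i) => [->|_]; rewrite ?xi ?andbT.
- apply: separated => h hh; apply: (eqb _ _ (h v)); rewrite eqxx fE //.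
  by apply/existsP => -[i]; rewrite ffunE.
move=> i; apply: separated => h hh; have [[j hj]|none] := cases h; last by rewrite f_const.
apply: (eqb _ _ (h v)); rewrite (f_sep _ hh hj) ffunE.
case: (eqVneq j i) => [<-|ji]; first by rewrite hj.
apply/esym/negbTE/negP => hi; case/eqP: ji; apply: u_inj.
exact: (neighbour_uniq hh (edges j) (edges i)).
Qed.

End Corner.

Lemma cubulation_flag (v : Y) : flag_link v.
Proof.
move=> n u single pairs.
have edges i : covers v (u i).
  have [f [[_ fa] <- fu]] := single i; have := fu ord0; rewrite (tnth_nth v) /= => <-.
  suff -> : [ffun j => j == ord0] = toggle [ffun=> false] (ord0 : 'I_1) by apply: fa.
  by apply/ffunP => j; rewrite !ffunE.
have tog l (i : 'I_l) : toggle [ffun=> false] i = [ffun j => j == i].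
  by apply/ffunP => j; rewrite !ffunE.
pose i0 : 'I_2 := ord0; pose i1 : 'I_2 := ord_max.
have u_inj : injective u.
  move=> i j uij; apply: contrapT => /eqP ij; have [f [cf _ fu]] := pairs i j ij.
  have := fu i0; have := fu i1; rewrite !(tnth_nth v) /= uij => <-.
  by move=> /(median_cube_inj cf)/ffunP/(_ i0); rewrite !ffunE.
have joins i j : i != j -> exists p, forall h, median_hom h ->
    (h p != h v) = (h (u i) != h v) || (h (u j) != h v).
  move=> /pairs [f [cf <- fu]].
  have := fu i0; have := fu i1; rewrite !(tnth_nth v) /= => <- <-.
  exists (f [ffun=> true]) => h hh; rewrite -!tog.
  apply/(cube_hom_sepP (median_cube_hom cf hh))/orP => [[k [_]]|].
    case: k => -[|[|//]] p hk; [left|right]; move: hk; congr (h (f (toggle _ _)) != _); exact: val_inj.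
  by case=> hk; [exists i0|exists i1]; rewrite !ffunE.
have [g [cg g0 gu]] := cube_of_corner edges u_inj joins.
by exists g.
Qed.

(** The quadrangle condition: two neighbours a, b of z on the way to o span a
square with z, whose fourth vertex is the median of o, a and b. *)
Lemma median_square (o z a b : M) : covers a z -> covers b z -> a <> b ->
  m o z a = a -> m o z b = b ->
  [/\ covers (m o a b) a, covers (m o a b) b & exists f : {ffun 'I_2 -> bool} -> M,
  [/\ median_cube f, f (square_corner false false) = m o a b,
      f (square_corner true false) = a, f (square_corner true true) = z &
      f (square_corner false true) = b]].
Proof.
move=> az bz ab oa ob; set x := m o a b.
(* Since z is adjacent to the distinct points a and b, it is their median. *)
have abz : m a b z = z.
  have [_ /(_ b) A] := az; have [_ /(_ a) B] := bz.
  rewrite mC23 in A; rewrite mC23 mC12 in B.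
  case: A => // A; case: B => // B; case: ab; exact: etrans (esym A) B.
have par h : median_hom h -> [|| [&& h x == h a, h x == h b & h x == h z],
    [&& h x != h a, h z == h a & h x == h b] | [&& h x != h b, h z == h b & h x == h a]].
  move=> hh; have := congr1 h oa; have := congr1 h ob; have := congr1 h abz.
  rewrite /x !hh; by case: (h o) (h a) (h b) (h z) => -[] [] [].
have xa : covers x a.
  apply: covers_parallel bz _ => h /par.
  by case: (h x) (h a) (h b) (h z) => -[] [] [].
have xb : covers x b.
  apply: covers_parallel az _ => h /par.
  by case: (h x) (h a) (h b) (h z) => -[] [] [].
pose f (u : {ffun 'I_2 -> bool}) : M :=
  if u ord0 then (if u ord_max then z else a) else (if u ord_max then b else x).
split=> //; exists f; split; rewrite /f ?ffunE //=.
have hf h u : median_hom h -> h (f u) =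
    h x (+) ((h x != h a) && u ord0) (+) ((h x != h b) && u ord_max).
  move=> /par; rewrite /f.
  by case: (u ord0) (u ord_max) => -[]; case: (h x) (h a) (h b) (h z) => -[] [] [].
split=> [u v w|u [[|[|//]] p]].
- apply: separated => h hh; rewrite hh !hf //; move: (par h hh); rewrite !ffunE.
  case: (h x) (h a) (h b) (h z) => -[] [] [] //= _;
  by case: (u ord0) (u ord_max) (v ord0) (v ord_max) (w ord0) (w ord_max) => -[] [] [] [] [].
- by rewrite /f !ffunE /= addbT addbF; case: (u _) (u _) => -[] //=; apply: covers_sym.
- by rewrite /f !ffunE /= addbT addbF; case: (u _) (u _) => -[] //=; apply: covers_sym.
Qed.

Hypothesis inhabited : exists x : M, True.
Variable rk : M -> M -> nat.
Hypothesis rk_add : forall x y z, m x y z = z -> (rk x z + rk z y = rk x y)%N.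
Hypothesis rk0 : forall x y, rk x y = 0%N -> x = y.

(** Paths from o along which every vertex lies between o and its successor, with
their last vertex as an index. They play the role of geodesics. *)
Inductive monotone (o : M) : seq M -> M -> Prop :=
| monotone_nil : monotone o [:: o] o
| monotone_step l a z : monotone o l a -> covers a z -> m o z a = a ->
    monotone o (rcons l z) z.

Lemma last_cover o z : o <> z -> exists2 a, covers a z & m o z a = a.
Proof.
have [k] := ubnP (rk o z); elim: k => // k IH in o *; rewrite ltnS => ok oz.
case: (pselect (forall w, m o z w = o \/ m o z w = z)) => [ow|].
  by exists o => //; median_identity.
move=> /existsNP[w /not_orP[wo wz]].
have ow : m o z (m o z w) = m o z w by median_identity.
have [||a az wa] := IH (m o z w) => //.
  have := rk_add ow; case E: (rk o (m o z w)) => [|r]; last lia.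
  by case: wo; rewrite -(rk0 E).
exists a => //; apply: separated => h hh; have := congr1 h wa; rewrite !hh.
by case: (h o) (h z) (h a) (h w) => -[] [] [].
Qed.

Lemma monotone_exists o z : exists l, monotone o l z.
Proof.
have [k] := ubnP (rk o z); elim: k => // k IH in z *; rewrite ltnS => ok.
case: (pselect (o = z)) => [<-|oz]; first by exists [:: o]; constructor.
have [a az oa] := last_cover oz; have [l ol] : exists l, monotone o l a; last first.
  by exists (rcons l z); apply: monotone_step ol _ _.
apply: IH; have := rk_add oa; case E: (rk a z) => [|r]; last lia.
by case: az => /(_ (rk0 E)).
Qed.

Lemma monotone_last o l z : monotone o l z -> exists l', l = rcons l' z.
Proof. by case=> [|l' a w _ _ _]; [exists [::]|exists l']. Qed.

Lemma monotone_inv o l z : monotone o l z -> (z = o /\ l = [:: o]) \/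
  exists l' a, [/\ l = rcons l' z, monotone o l' a, covers a z & m o z a = a].
Proof. by case=> [|l' a w oa aw ow]; [left|right; exists l', a]. Qed.

Lemma homotopic_rcons (p q : seq Y) a : homotopic p q -> homotopic (rcons p a) (rcons q a).
Proof.
elim=> {p q}.
- by move=> p; apply: homotopic_refl.
- by move=> p q _; apply: homotopic_sym.
- by move=> p q r _ pq _; apply: homotopic_trans.
- move=> p q x y xy; rewrite !rcons_cat /=; exact: (homotopic_backtrack p (rcons q a) xy).
- move=> p q f cf; rewrite !rcons_cat /=; exact: (homotopic_square p (rcons q a) cf).
Qed.

(** If the two paths arrive at z from different vertices a and b, replace them by
paths through the median of o, a and b, and flip the resulting square. *)
Lemma monotone_homotopic o l l' z : monotone o l z -> monotone o l' z ->
  @homotopic Y l l'.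
Proof.
have [k] := ubnP (rk o z); elim: k => // k IH in z l l' *; rewrite ltnS => ok.
have loop a : covers a o -> m o o a = a -> False by move=> [ao _]; rewrite m_id => /esym.
have less a : covers a z -> m o z a = a -> rk o a < k.
  move=> az oa; have := rk_add oa; case E: (rk a z) => [|r]; last lia.
  by case: az => /(_ (rk0 E)).
move=> /monotone_inv[[-> ->]|[p [a [-> pa az oa]]]].
  by move=> /monotone_inv[[_ ->]|[q [b [_ _ /loop h /h]]]//]; apply: homotopic_refl.
move=> /monotone_inv[[E _]|[q [b [-> qb bz ob]]]].
  by rewrite E in az oa; case: (loop a).
case: (pselect (a = b)) => [E|ab].
  by subst b; apply: homotopic_rcons; apply: IH pa qb; apply: less.
have [xa xb [f [cf f00 f10 f11 f01]]] := median_square az bz ab oa ob.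
set x := m o a b in xa xb f00.
have [r rx] := monotone_exists o x.
have ra : monotone o (rcons r a) a.
  by apply: monotone_step rx xa _; rewrite /x; median_identity.
have rb : monotone o (rcons r b) b.
  by apply: monotone_step rx xb _; rewrite /x; median_identity.
have ha := homotopic_rcons z (IH _ _ _ (less a az oa) pa ra).
have hb := homotopic_rcons z (IH _ _ _ (less b bz ob) qb rb).
apply: homotopic_trans ha (homotopic_trans _ (homotopic_sym hb)).
have [s Es] := monotone_last rx; subst r.
rewrite -!cats1 -!catA /=.
have := @homotopic_square Y s [::] f cf; by rewrite f00 f10 f11 f01.
Qed.

(** Each edge of a path moves away from or towards o; in the second case the
extended path is homotopic to one that backtracks. *)
Lemma path_monotone o p l : edge_path (@adjacent Y) o p -> monotone o l (last o p) ->
  homotopic (o :: p : seq Y) l.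
Proof.
elim/last_ind: p l => [|p w IH] l; first by move=> _ ol; apply: monotone_homotopic ol; constructor.
rewrite /edge_path rcons_path last_rcons => /andP[op /asboolP/adjacentE zw] ol.
set z := last o p in op zw IH *.
have [lz oz] := monotone_exists o z.
have hz := homotopic_rcons w (IH lz op oz).
rewrite -rcons_cons; apply: homotopic_trans hz _.
have [_ /(_ o) zwo] := zw; rewrite mC23 mC12 in zwo.
case: zwo => E.
  apply: monotone_homotopic ol; apply: monotone_step oz zw _.
  by rewrite mC23.
have lz' : monotone o (rcons l z) z by apply: monotone_step ol (covers_sym zw) _.
apply: homotopic_trans (homotopic_rcons w (monotone_homotopic oz lz')) _.
have [l' ->] := monotone_last ol; rewrite -!cats1 -!catA /=.
have := @homotopic_backtrack Y l' [::] w z; apply; apply/adjacentE; exact: covers_sym.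
Qed.

Lemma monotone_path o l z : monotone o l z ->
  exists p, [/\ l = o :: p, edge_path (@adjacent Y) o p & last o p = z].
Proof.
elim=> [|{}l a w _ [p [-> op oa]] aw _]; first by exists [::].
exists (rcons p w); split; rewrite ?last_rcons // /edge_path rcons_path.
by apply/andP; split=> //; apply/asboolP/adjacentE; rewrite oa.
Qed.

Theorem cubulation_CAT0 : CAT0 Y.
Proof.
split; last exact: cubulation_flag.
split=> [//|o z|o p op oo].
  have [l /monotone_path[p [_ op oz]]] := monotone_exists o z.
  by exists (size p), p.
by apply: path_monotone op _; rewrite oo; constructor.
Qed.

End Cubulation.

(** * Finiteness and proper cocompact actions *)

Local Open Scope group_scope.
Local Open Scope classical_set_scope.

Lemma finite_uniform T (A : set T) (Q : T -> nat -> Prop) : finite_set A ->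
  (forall x C C', Q x C -> (C <= C')%N -> Q x C') ->
  (forall x, A x -> exists C, Q x C) -> exists C, forall x, A x -> Q x C.
Proof.
elim/Pchoice: T => T in A Q *; move=> /finite_seqP[s ->] mono.
elim: s => [|x s IH] bound; first by exists 0%N.
have [y ys|C hC] := IH; first by apply: bound; rewrite /= inE ys orbT.
have [|C' hC'] := bound x; first by rewrite /= inE eqxx.
exists (maxn C C') => y; rewrite /= inE => /orP[/eqP ->|ys].
  exact: mono hC' (leq_maxr _ _).
exact: mono (hC y ys) (leq_maxl _ _).
Qed.

Lemma finite_bounded T (A : set T) (w : T -> nat) : finite_set A ->
  exists C, forall x, A x -> (w x <= C)%N.
Proof.
move=> fA; apply: (finite_uniform (Q := fun x C => (w x <= C)%N) fA).
  by move=> x C C'; apply: leq_trans.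
by move=> x _; exists (w x).
Qed.

Lemma finite_enum T (A : set T) (x0 : T) : finite_set A ->
  exists n (f : nat -> T), forall x, A x -> exists2 i, (i < n)%N & f i = x.
Proof.
elim/Pchoice: T => T in A x0 *; move=> /finite_seqP[s ->].
exists (size s), (nth x0 s) => x /= xs; exists (index x s); first by rewrite index_mem.
exact: nth_index.
Qed.

Lemma finite_injective T U (A : set T) (f : T -> U) :
  (forall x y, A x -> A y -> f x = f y -> x = y) -> finite_set (f @` A) -> finite_set A.
Proof.
move=> f_inj fin; case: (pselect (exists x, A x)) => [[x0 _]|none]; last first.
  by apply: sub_finite_set (finite_set0 T) => x Ax; case: none; exists x.
pose g y := if pselect (exists x, A x /\ f x = y) is left ex then sval (cid ex) else x0.
apply: sub_finite_set (finite_image g fin) => x Ax; exists (f x); first by exists x.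
rewrite /g; case: pselect => [ex|]; last by case; exists x.
by have [? ?] := svalP (cid ex); apply: f_inj.
Qed.

(** Bounds the dimension of cubes with all neighbours of one corner in a
given finite set. *)
Lemma finite_dimension T (A : set T) (x0 : T) : finite_set A ->
  exists N, forall n (u : 'I_n -> T), injective u -> (forall i, A (u i)) -> (n <= N)%N.
Proof.
move=> /(finite_enum x0)[N [f fA]]; exists N => n u u_inj uA.
have idx i : exists j : 'I_N, f j = u i.
  by have [j jN fj] := fA _ (uA i); exists (Ordinal jN).
pose v i := sval (cid (idx i)).
have v_inj : injective v.
  move=> i j vij; apply: u_inj.
  by rewrite -(svalP (cid (idx i))) -(svalP (cid (idx j))) -/(v i) vij.
by have := leq_card v v_inj; rewrite !card_ord.
Qed.

Section LocallyFinite.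
Variables (H : groupType) (X : cubeComplex) (act : H -> X -> X).
Hypothesis (hact : proper_cocompact_cubical_action act).
Hypothesis conn : graph_connected (@adjacent X).
Local Notation d := (gdist (@adjacent X)).

Lemma act1 x : act 1 x = x. Proof. by case: hact => -[]. Qed.
Lemma actM g h x : act (g * h) x = act g (act h x). Proof. by case: hact => -[]. Qed.
Lemma actK g x : act g^-1 (act g x) = x. Proof. by rewrite -actM mulVg act1. Qed.
Lemma actVK g x : act g (act g^-1 x) = x. Proof. by rewrite -actM mulgV act1. Qed.

Lemma act_adjacent g x y : adjacent x y -> adjacent (act g x) (act g y).
Proof.
by case: hact => -[_ _ cub] _ _ [f [cf <- <-]]; exists (act g \o f); split=> //; apply: cub.
Qed.

Lemma act_walk g n x y : walk (@adjacent X) n x y -> walk (@adjacent X) n (act g x) (act g y).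
Proof.
elim: n x => [|n IH] x; first by move=> /walk0 ->; apply/walk0.
by move=> /walkS[z xz /IH zy]; apply/walkS; exists (act g z) => //; apply: act_adjacent.
Qed.

Lemma act_dist g x y : d (act g x) (act g y) = d x y.
Proof.
have le h a b : (d (act h a) (act h b) <= d a b)%N.
  by apply: (gdist_le conn); apply: act_walk; apply: gdist_walk.
by apply/eqP; rewrite eqn_leq le /= -{1}(actK g x) -{1}(actK g y) le.
Qed.

Lemma finite_transporter x y : finite_set [set g | act g x = y].
Proof.
have [_ prop _] := hact.
have fin2 : finite_set [set x; y] by apply: finite_set2.
by apply: sub_finite_set (prop _ fin2) => g gx; exists x; [left|right].
Qed.

Lemma finite_neighbours (v : X) : finite_set [set w | adjacent v w].
Proof.
have [_ _ [K finK Kcubes]] := hact.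
pose F := \bigcup_(y in K) [set g | act g v = y].
have finF : finite_set F by apply: bigcup_finite => // y _; apply: finite_transporter.
have fin : finite_set (\bigcup_(g in F) act g^-1 @` K).
  by apply: bigcup_finite => // g _; apply: finite_image.
apply: sub_finite_set fin => w [f [cf fv fw]].
have [g gK] := Kcubes 1%N f cf.
have gv := gK [ffun=> false]; have gw := gK [ffun=> true]; rewrite fv in gv; rewrite fw in gw.
exists g; first by exists (act g v).
by exists (act g w) => //; rewrite actK.
Qed.

Lemma finite_ball (v : X) n : finite_set [set w | (d v w <= n)%N].
Proof.
elim: n => [|n IH].
  apply: sub_finite_set (finite_set1 v) => w /=; rewrite leqn0 => /eqP.
  by move/(gdist_eq0 conn).
pose B := [set w | (d v w <= n)%N].
have finU : finite_set (B `|` \bigcup_(u in B) [set w | adjacent u w]).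
  by rewrite finite_setU; split=> //; apply: bigcup_finite => // u _; apply: finite_neighbours.
apply: sub_finite_set finU => w /=.
rewrite leq_eqVlt ltnS => /orP[/eqP dw|dw]; [right|by left].
have [u wu du] := gdist_last_edge (@adjacent_sym X) conn dw.
by exists u; [rewrite /B /= du|apply: adjacent_sym].
Qed.

(** The list may contain repetitions and other vertices, so that one D serves all
vertices. *)
Lemma degree_bounded : exists D, forall v : X, exists f : nat -> X,
  forall w, adjacent v w -> exists2 i, (i < D)%N & f i = w.
Proof.
have [_ _ [K finK Kcubes]] := hact.
pose Q (v : X) D := exists f : nat -> X, forall w, adjacent v w -> exists2 i, (i < D)%N & f i = w.
have [||D hD] := finite_uniform (Q := Q) finK.
- move=> v C C' [f hf] CC'; exists f => w vw; have [i iC fi] := hf w vw.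
  by exists i => //; apply: leq_trans iC CC'.
- move=> v _; have [D [f hf]] := finite_enum v (finite_neighbours v).
  by exists D, f => w vw; apply: hf.
exists D => v.
have [g gv] := Kcubes 0%N (fun=> v) (cube_vertex _).
have {}gv := gv [ffun=> false]; have [f hf] := hD _ gv.
exists (act g^-1 \o f) => w vw; have [i iD fi] := hf _ (act_adjacent g vw).
by exists i => //=; rewrite fi actK.
Qed.

End LocallyFinite.

(** * The median of a CAT(0) cube complex *)

Section CAT0Median.
Variable X : cubeComplex.
Hypothesis hX : CAT0 X.
Local Notation d := (gdist (@adjacent X)).
Local Notation med := (@med X (@adjacent X)).
Local Notation side := (@side X (@adjacent X)).

Let sym := @adjacent_sym X.
Lemma cat0_connected : graph_connected (@adjacent X).
Proof. exact: connectedX hX.1. Qed.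
Let conn := cat0_connected.
Let bip := cat0_bipartite hX.1.
Let quad := cat0_quadrangle hX.2 hX.1.
Let k23 := cat0_no_K23 hX.2 hX.1.

Lemma cat0_medP a b c : median_point (@adjacent X) a b c (med a b c).
Proof. exact: (medP sym conn bip quad). Qed.

Lemma cat0_median a b c v : is_median (@adjacent X) a b c v <-> v = med a b c.
Proof.
have gE := on_geodesicE conn.
split=> [[/gE h1 /gE h2 /gE h3]|->].
  exact: (median_point_uniq sym conn bip quad k23 _ (cat0_medP a b c)).
by have [h1 h2 h3] := cat0_medP a b c; split; apply/gE.
Qed.

Lemma cat0_side_hom u v : adjacent u v -> median_hom med (side u v).
Proof. by move=> uv a b c; apply: (side_med sym conn bip quad k23). Qed.

Lemma cat0_separating_edge x y : x <> y ->
  exists v, [/\ adjacent x v, side x v x & ~~ side x v y].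
Proof. exact: (separating_edge sym conn bip). Qed.

Lemma cat0_separated x y : (forall u v, adjacent u v -> side u v x = side u v y) -> x = y.
Proof.
move=> same; apply: contrapT => /cat0_separating_edge[v [xv xx xy]].
by move: xy; rewrite -(same _ _ xv) xx.
Qed.

Lemma cat0_between a b c : d a c + d c b = d a b <-> med a b c = c.
Proof.
split; first exact: (med_between sym conn bip quad k23).
by have [h _ _] := cat0_medP a b c => <-.
Qed.

Lemma cat0_lipschitz x x' y y' z z' :
  d (med x y z) (med x' y' z') <= d x x' + d y y' + d z z'.
Proof. exact: (med_lipschitz sym conn bip quad k23). Qed.

Variables (H : groupType) (act : H -> X -> X).
Hypothesis (hact : proper_cocompact_cubical_action act).

Lemma act_med g x y z : act g (med x y z) = med (act g x) (act g y) (act g z).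
Proof.
have [h1 h2 h3] := cat0_medP x y z.
apply: (median_point_uniq sym conn bip quad k23 _ (cat0_medP _ _ _)).
by split; rewrite /between !(act_dist hact conn).
Qed.

End CAT0Median.

(** * Generated subalgebras and balls in word metrics *)

Section Generation.
Variables (M : Type) (m : M -> M -> M -> M) (A : set M).
Hypothesis m_idem : forall x, m x x x = x.

Fixpoint level n : set M :=
  if n is n'.+1 then [set z | exists a b c, [/\ level n' a, level n' b, level n' c & z = m a b c]]
  else A.

Lemma levelS n : level n `<=` level n.+1.
Proof. by move=> x xn; exists x, x, x; rewrite m_idem. Qed.

Lemma level_le k n : (k <= n)%N -> level k `<=` level n.
Proof.
move=> /subnK <-; elim: (n - k)%N => [|j IH] //.
by apply: subset_trans IH _; exact: levelS.
Qed.

Definition generated : set M := [set x | exists n, level n x].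

Lemma generated_m x y z : generated x -> generated y -> generated z -> generated (m x y z).
Proof.
move=> [i xi] [j yj] [k zk]; exists (maxn i (maxn j k)).+1.
exists x, y, z; split=> //; [apply: level_le xi|apply: level_le yj|apply: level_le zk]; lia.
Qed.

Lemma generated_ind (Q : M -> Prop) : (forall x, A x -> Q x) ->
  (forall x y z, Q x -> Q y -> Q z -> Q (m x y z)) -> forall x, generated x -> Q x.
Proof.
move=> QA Qm x [n]; elim: n x => [|n IH] x; first exact: QA.
by move=> [a [b [c [/IH qa /IH qb /IH qc ->]]]]; apply: Qm.
Qed.

Variable J : finType.
Hypothesis isolated : forall x, generated x -> exists xi : J -> M -> bool,
  (forall j, median_hom m (xi j)) /\
  forall y, generated y -> (forall j, xi j y = xi j x) -> y = x.

(** The point x is recognised by its image under the map to the Boolean cube with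
coordinates xi. The images of the levels form an increasing sequence of subsets of
that finite cube, in which each term determines the next; so it is constant from
an index on that is bounded in terms of J alone, and the bound is uniform in x even
though the coordinates xi depend on x. *)
Lemma generated_level : exists N, forall x, generated x -> level N x.
Proof.
exists #|{ffun J -> bool}| => x [k xk].
have [|xi [xi_hom xi_sep]] := isolated (x := x); first by exists k.
pose code y : {ffun J -> bool} := [ffun j => xi j y].
pose B n : {set {ffun J -> bool}} := [set c | `[< exists2 y, level n y & code y = c >]]%SET.
have BP n c : reflect (exists2 y, level n y & code y = c) (c \in B n).
  by rewrite inE; apply: asboolP.
have Bmono i j : (i <= j)%N -> B i \subset B j.
  move=> ij; apply/fintype.subsetP => c /BP[y yi yc]; apply/BP; exists y => //.
  exact: level_le yi.
have code_m a b c : code (m a b c) = [ffun j => maj (code a j) (code b j) (code c j)].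
  by apply/ffunP => j; rewrite !ffunE xi_hom.
have Bnext i j : B i \subset B j -> B i.+1 \subset B j.+1.
  move=> /fintype.subsetP ij; apply/fintype.subsetP => c /BP[y [y1 [y2 [y3 [h1 h2 h3 ->]]]] <-].
  have lift z : level i z -> exists2 z', level j z' & code z' = code z.
    by move=> zi; apply/BP/ij/BP; exists z.
  have [[z1 l1 c1] [z2 l2 c2] [z3 l3 c3]] := And3 (lift _ h1) (lift _ h2) (lift _ h3).
  by apply/BP; exists (m z1 z2 z3); [exists z1, z2, z3|rewrite !code_m c1 c2 c3].
have [n nF Bn] : exists2 n, (n <= #|{ffun J -> bool}|)%N & B n.+1 \subset B n.
  apply: contrapT => none.
  (* Without a stable index the cardinality would grow at every step. *)
  have grow n : (n <= #|{ffun J -> bool}|.+1)%N -> (n <= #|B n|)%N.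
    elim: n => // n IH nF; apply: leq_ltn_trans (IH (ltnW nF)) _; apply: proper_card.
    rewrite properE Bmono //=; apply/negP => Bn; apply: none; by exists n.
  have := grow _ (leqnn _); have := max_card (mem (B #|{ffun J -> bool}|.+1)).
  by rewrite ltnNge => ->.
have Bstable j : B (n + j)%N \subset B n.
  elim: j => [|j IH]; first by rewrite addn0.
  by rewrite addnS; apply: fintype.subset_trans (Bnext _ _ IH) Bn.
have : code x \in B n.
  apply: (fintype.subsetP (Bstable k)); apply/BP; exists x => //.
  by apply: level_le xk; rewrite leq_addl.
move=> /BP[y yn yx]; have -> : x = y.
  apply/esym/xi_sep; first by exists n.
  by move=> j; have /ffunP/(_ j) := yx; rewrite !ffunE.
exact: level_le nF _ yn.
Qed.

End Generation.

Section WordBalls.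
Variables (G : groupType) (S : set G).
Hypothesis hS : finite_generating_set S.

Definition letters : set G := [set s | S s \/ S s^-1].

Lemma finite_letters : finite_set letters.
Proof.
have [finS _] := hS.
apply: (sub_finite_set (B := S `|` (fun s => s^-1) @` S)).
  by move=> s [Ss|Ss]; [left|right; exists s^-1 => //; rewrite invgK].
by rewrite finite_setU; split=> //; apply: finite_image.
Qed.

Lemma cayley_connected : graph_connected (cayley_edge S).
Proof.
move=> a b; have [_ /(_ (a^-1 * b)) [w wS ab]] := hS.
exists (size w); rewrite -[b](mulVKg a) ab.
elim: w a wS {ab} => [|s w IH] a wS; first by rewrite big_nil mulg1; apply/walk0.
rewrite big_cons mulgA; apply/walkS; exists (a * s).
  by exists s => //; apply: wS; rewrite inE eqxx.
by apply: IH => x xw; apply: wS; rewrite inE xw orbT.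
Qed.

Lemma word_ball C : exists2 F : set G, finite_set F &
  forall a b, (word_dist S a b <= C)%N -> F (a^-1 * b).
Proof.
suff [F finF FP] : exists2 F : set G, finite_set F &
    forall n a b, (n <= C)%N -> walk (cayley_edge S) n a b -> F (a^-1 * b).
  by exists F => // a b ab; apply: FP ab _; apply: gdist_walk; apply: cayley_connected.
elim: C => [|C [F finF FP]].
  exists [set 1] => [|n a b]; first exact: finite_set1.
  by rewrite leqn0 => /eqP -> /walk0 ->; rewrite mulVg.
exists (F `|` [set s * f | s in letters & f in F]).
  by rewrite finite_setU; split=> //; apply: finite_image2 => //; apply: finite_letters.
move=> [|n] a b; first by move=> _ ab; left; apply: FP ab.
rewrite ltnS => nC /walkS[c [s sS ->] cb]; right; exists s => //.
exists ((a * s)^-1 * b); first exact: FP nC cb.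
by rewrite invgM -mulgA mulVKg.
Qed.

End WordBalls.

(** * The coinduced action and the hull of an orbit *)

Section Coinduction.
Variables (G : groupType) (P : pred G) (H : subGroupType P).
Variables (T : seq G) (hT : forall g, exists t h, [/\ t \in T, P h & g = t * h]).
Variables (X : cubeComplex) (hX : CAT0 X) (act : H -> X -> X).
Hypothesis hact : proper_cocompact_cubical_action act.
Variable p : X.
Local Notation d := (gdist (@adjacent X)).
Local Notation med := (@med X (@adjacent X)).
Local Notation side := (@side X (@adjacent X)).
Let conn := cat0_connected hX.
Let dC := gdistC (@adjacent_sym X) conn.
Let tri := gdist_triangle conn.

Lemma subgroup_val g : P g -> exists h : H, val h = g.
Proof. by move=> Pg; exists (insubd 1 g); rewrite val_insubd Pg. Qed.

Lemma val_inv (h : H) : val h^-1 = (val h)^-1.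
Proof. exact: gmulfV. Qed.

Lemma subgroup_mulr g (h : H) : P (g * val h) = P g.
Proof.
apply/idP/idP => [/subgroup_val[k kE]|/subgroup_val[k <-]]; last by rewrite -valM; apply: valP.
have -> : g = val (k * h^-1) by rewrite valM val_inv kE mulgK.
exact: valP.
Qed.

(** A representative of the left coset of g that depends on this coset only, as
[rep_mulr] shows: the set from which it is chosen does. *)
Definition rep (g : G) : G := xget 1 [set t | t \in T /\ P (t^-1 * g)].

Lemma repP g : rep g \in T /\ P ((rep g)^-1 * g).
Proof.
rewrite /rep; case: xgetP => [t _ //|none].
have [t [h [tT Ph E]]] := hT g; case: (none t); split=> //; by rewrite E mulKg.
Qed.

Lemma rep_mulr g (h : H) : rep (g * val h) = rep g.
Proof.
rewrite /rep; congr xget; apply/seteqP; split=> t /=; by rewrite mulgA subgroup_mulr.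
Qed.

Definition cocycle (g : G) : H := insubd 1 ((rep g)^-1 * g).

Lemma val_cocycle g : val (cocycle g) = (rep g)^-1 * g.
Proof. by rewrite val_insubd (repP g).2. Qed.

Lemma cocycle_mulr g (h : H) : cocycle (g * val h) = cocycle g * h.
Proof. by apply: val_inj; rewrite valM !val_cocycle rep_mulr mulgA. Qed.

(** Elements of the H-set X coinduced to G, on which G acts by [translate]. They are
determined by their values at the finitely many coset representatives. *)
Definition equivariant (phi : G -> X) := forall g (h : H), phi (g * val h) = act h^-1 (phi g).

Lemma equivariant_ext phi psi : equivariant phi -> equivariant psi ->
  {in T, phi =1 psi} -> phi = psi.
Proof.
move=> ephi epsi same; apply/funext => g.
have [t [h [tT /subgroup_val[k <-] ->]]] := hT g.
by rewrite ephi epsi same.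
Qed.

(** A point of the coinduced space whose orbit map sends g, at the coordinate t, to h p
for some h in H at bounded distance from t^-1 g. *)
Definition base (g : G) : X := act (cocycle g)^-1 p.

Lemma base_equivariant : equivariant base.
Proof. by move=> g h; rewrite /base cocycle_mulr invgM (actM hact). Qed.

Definition translate (g : G) (phi : G -> X) : G -> X := fun x => phi (g^-1 * x).

Lemma translate1 phi : translate 1 phi = phi.
Proof. by apply/funext => x; rewrite /translate invg1 mul1g. Qed.

Lemma translateM g h phi : translate (g * h) phi = translate g (translate h phi).
Proof. by apply/funext => x; rewrite /translate invgM mulgA. Qed.

Lemma translate_equivariant g phi : equivariant phi -> equivariant (translate g phi).
Proof. by move=> ephi x h; rewrite /translate mulgA ephi. Qed.

Definition pmed (a b c : G -> X) : G -> X := fun x => med (a x) (b x) (c x).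

Lemma pmed_equivariant a b c : equivariant a -> equivariant b -> equivariant c ->
  equivariant (pmed a b c).
Proof. by move=> ea eb ec x h; rewrite /pmed ea eb ec -(act_med hX hact). Qed.

Lemma med_idem x : med x x x = x.
Proof. by apply/(cat0_between hX); rewrite (gdist_refl conn). Qed.

Lemma pmed_idem a : pmed a a a = a.
Proof. by apply/funext => x; apply: med_idem. Qed.

Definition orbit : set (G -> X) := [set translate g base | g in setT].

Notation in_hull := (generated pmed orbit).

Lemma in_hull_equivariant phi : in_hull phi -> equivariant phi.
Proof.
move: phi; apply: generated_ind => [_ [g _ <-]|]; last exact: pmed_equivariant.
exact/translate_equivariant/base_equivariant.
Qed.

Lemma in_hull_translate g phi : in_hull phi -> in_hull (translate g phi).
Proof.
move: phi; apply: generated_ind => [_ [h _ <-]|a b c ha hb hc]; last first.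
  exact: (generated_m pmed_idem ha hb hc).
by exists 0%N; exists (g * h) => //; rewrite translateM.
Qed.

(** A point phi of the hull is isolated from the others by the walls adjacent to the
vertices phi t, with t among the coset representatives; their number is bounded
because degrees in X are. *)
Lemma in_hull_level : exists N, forall phi, in_hull phi -> level pmed orbit N phi.
Proof.
have [D hD] := degree_bounded hact.
apply: (generated_level pmed_idem (J := 'I_(size T) * 'I_D)%type) => phi phi_hull.
pose f v := sval (cid (hD v)).
have fP v w : adjacent v w -> exists2 i : 'I_D, true & f v i = w.
  by move=> vw; have [i iD fi] := svalP (cid (hD v)) w vw; exists (Ordinal iD).
(* If the listed vertex is not a neighbour of phi t, the coordinate is constant. *)
pose xi (j : 'I_(size T) * 'I_D) (psi : G -> X) :=
  let t := nth 1 T j.1 in let v := phi t in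
  `[< adjacent v (f v j.2) >] && side v (f v j.2) (psi t).
exists xi; split=> [[i j] a b c|psi psi_hull same].
  rewrite /xi /=; case: asboolP => //= vw; exact: (cat0_side_hom hX vw).
apply: (equivariant_ext (in_hull_equivariant psi_hull) (in_hull_equivariant phi_hull)) => t tT.
apply: contrapT => ne; have [v [tv stt sts]] := cat0_separating_edge hX (not_eq_sym ne).
have [j _ fj] := fP _ _ tv.
have iT : (index t T < size T)%N by rewrite index_mem.
have := same (Ordinal iT, j); rewrite /xi /= nth_index // fj stt (negbTE sts).
by have /asboolT -> := tv.
Qed.

(** Uniform distance over all of G, rather than over the representatives only, so that
it is visibly invariant under translation. *)
Definition near R (phi psi : G -> X) := forall x, (d (phi x) (psi x) <= R)%N.

Lemma near_sym R phi psi : near R phi psi -> near R psi phi.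
Proof. by move=> h x; rewrite dC. Qed.

Lemma near_trans Q R phi psi chi : near Q phi psi -> near R psi chi -> near (Q + R) phi chi.
Proof. by move=> h1 h2 x; have := tri (psi x) (phi x) (chi x); have := h1 x; have := h2 x; lia. Qed.

Lemma near_translate R g phi psi : near R phi psi -> near R (translate g phi) (translate g psi).
Proof. by move=> h x; apply: h. Qed.

Lemma near_translateV R g phi psi : near R phi (translate g psi) -> near R (translate g^-1 phi) psi.
Proof. by move=> /(@near_translate _ g^-1); rewrite -translateM mulVg translate1. Qed.

Lemma near_pmed Q1 Q2 Q3 a a' b b' c c' : near Q1 a a' -> near Q2 b b' -> near Q3 c c' ->
  near (Q1 + Q2 + Q3) (pmed a b c) (pmed a' b' c').
Proof.
move=> h1 h2 h3 x; have := cat0_lipschitz hX (a x) (a' x) (b x) (b' x) (c x) (c' x).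
have := h1 x; have := h2 x; have := h3 x; rewrite /pmed; lia.
Qed.

Lemma near_on_T R phi psi : equivariant phi -> equivariant psi ->
  (forall t, t \in T -> d (phi t) (psi t) <= R)%N -> near R phi psi.
Proof.
move=> ephi epsi close_T g; have [t [h [tT /subgroup_val[k <-] ->]]] := hT g.
by rewrite ephi epsi (act_dist hact conn); apply: close_T.
Qed.

Lemma finite_near R phi : finite_set [set psi | equivariant psi /\ near R phi psi].
Proof.
pose values (U : seq G) (psi : G -> X) := map psi U.
apply: (finite_injective (f := values T)).
  move=> a b [ea _] [eb _] ab; apply: equivariant_ext => // t tT.
  by move/eq_in_map: ab; apply.
apply: (@sub_finite_set _ _ (values T @` [set psi | near R phi psi])).
  by move=> _ [psi [_ ?] <-]; exists psi.
elim: T => [|t U IH].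
  by apply: sub_finite_set (finite_set1 [::]) => _ [psi _ <-].
have fin := finite_image2 (fun x l => x :: l) (finite_ball hact conn (phi t) R) IH.
apply: sub_finite_set fin => _ [psi psi_near <-] /=.
by exists (psi t) => /=; [exact: psi_near|exists (values U psi) => //; exists psi].
Qed.

Lemma base_dist (a : H) x : d (base x) (act a p) = d p (act (cocycle x * a) p).
Proof.
by rewrite /base -(act_dist hact conn (cocycle x)) (actVK hact) (actM hact).
Qed.

Lemma finite_displacement (A : set G) : finite_set A ->
  exists C, forall h : H, A (val h) -> (d p (act h p) <= C)%N.
Proof.
move=> /(finite_bounded (fun g => d p (act (insubd 1 g) p)))[C hC].
by exists C => h /hC; rewrite valKd.
Qed.

(** The two points are translates of p by elements of H that differ, on the
right, by an element of a finite set independent of x. *)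
Lemma base_coarse (F : set G) : finite_set F -> exists C, forall x f, F f ->
  (d (base x^-1) (base (x * f)^-1) <= C)%N.
Proof.
move=> finF.
have finT : finite_set [set t | t \in T] by apply: finite_seq.
have fin1 := finite_image2 (fun t f : G => t^-1 * f) finT finF.
have fin2 := finite_image2 (fun g t : G => g * t) fin1 finT.
have [C hC] := finite_displacement fin2; exists C => x f Ff.
rewrite {2}/base base_dist; apply: hC.
exists ((rep x^-1)^-1 * f).
  by exists (rep x^-1); [exact: (repP x^-1).1|exists f].
exists (rep (x * f)^-1); first exact: (repP (x * f)^-1).1.
have inv2 (a b : G) : (a^-1 * b^-1)^-1 = b * a by rewrite invgM !invgK.
by rewrite valM val_inv !val_cocycle inv2 !mulgA mulgVK.
Qed.

Lemma base_val : exists C, forall h : H, (d (base (val h)^-1) (act h p) <= C)%N.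
Proof.
have finT : finite_set [set t | t \in T] by apply: finite_seq.
have [C hC] := finite_displacement (finite_image (fun t : G => t^-1) finT).
exists C => h; rewrite base_dist; apply: hC.
exists (rep (val h)^-1); first exact: (repP (val h)^-1).1.
by rewrite valM val_cocycle mulgVK.
Qed.

Section Coarse.
Variables (S : set G) (hS : finite_generating_set S).
Variables (mu : G -> G -> G -> G) (muH : H -> H -> H -> H) (r : G -> H).
Hypothesis hmuH : orbit_coarse_median act p muH.
Hypothesis hr : @coarse_inverse G S P H r.
Hypothesis hmu : close S mu (fun g1 g2 g3 => val (muH (r g1) (r g2) (r g3))).
Hypothesis hinv : left_invariant S mu.

Lemma base_word_dist C : exists D, forall a b, (word_dist S a b <= C)%N ->
  (d (base a^-1) (base b^-1) <= D)%N.
Proof.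
have [F finF hF] := word_ball hS C; have [D hD] := base_coarse finF.
by exists D => a b /hF /(hD a); rewrite mulVKg.
Qed.

(** The coarse median mu comes from medians of orbit points in X; all the bounded
ambiguities (of r, of muH and of mu) become bounded distances in X. *)
Lemma base_coarse_median : exists C, forall g1 g2 g3,
  (d (med (base g1^-1) (base g2^-1) (base g3^-1)) (base (mu g1 g2 g3)^-1) <= C)%N.
Proof.
have [C1 h1] := hmuH; have [C2 h2] := hr; have [C3 h3] := hmu.
have [D0 e0] := base_val; have [D2 e2] := base_word_dist C2; have [D3 e3] := base_word_dist C3.
have close_r g : (d (base g^-1) (act (r g) p) <= D2 + D0)%N.
  have := e2 _ _ (h2 g) => D2'; have := e0 (r g).
  rewrite dC; have := tri (base (val (r g))^-1) (act (r g) p) (base g^-1).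
  have := dC (base (val (r g))^-1) (act (r g) p); have := dC (base (val (r g))^-1) (base g^-1).
  move: D2'; rewrite -?[d (base g^-1) _]dC; lia.
exists (3 * (D2 + D0) + C1 + (D0 + D3))%N => g1 g2 g3.
set h := muH (r g1) (r g2) (r g3).
have m1 := h1 (r g1) (r g2) (r g3) _ (iffRL (cat0_median hX _ _ _ _) erefl).
have m2 := cat0_lipschitz hX (base g1^-1) (act (r g1) p) (base g2^-1) (act (r g2) p)
   (base g3^-1) (act (r g3) p).
have m3 := e3 _ _ (h3 g1 g2 g3); have m4 := e0 h.
have c1 := close_r g1; have c2 := close_r g2; have c3 := close_r g3.
rewrite -/h in m1 m3.
set q := med _ _ _; set q' := med (act _ _) _ _ in m1 m2; set b := base _.
rewrite dC in m1.
have := tri q' q b; have := tri (act h p) q' b; have := tri (base (val h)^-1) (act h p) b.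
rewrite -/q -/b in m2 m3.
rewrite (dC (act h p) (base _)) (dC (base (val h)^-1) b); lia.
Qed.

(** Where invariance enters: the coordinate at t compares the median of the
elements t^-1 g_i with t^-1 applied to the median of the g_i. Only finitely
many t matter, so the constants of invariance are uniformly bounded. *)
Lemma orbit_coarse_subalgebra : exists C, forall g1 g2 g3, exists g,
  near C (pmed (translate g1 base) (translate g2 base) (translate g3 base)) (translate g base).
Proof.
have [C hC] := base_coarse_median.
have finT : finite_set [set t | t \in T] by apply: finite_seq.
pose Q t D := forall g1 g2 g3,
  (d (base (mu (t^-1 * g1) (t^-1 * g2) (t^-1 * g3))^-1) (base (t^-1 * mu g1 g2 g3)^-1) <= D)%N.
have [||D hD] := finite_uniform (Q := Q) finT.
- by move=> t D D' h DD' g1 g2 g3; apply: leq_trans (h _ _ _) DD'.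
- move=> t _; have [C' hC'] := hinv t^-1; have [D hD] := base_word_dist C'.
  by exists D => g1 g2 g3; rewrite dC; apply: hD; apply: hC'.
exists (C + D)%N => g1 g2 g3; exists (mu g1 g2 g3).
apply: near_on_T => [||t tT].
- by apply: pmed_equivariant; apply/translate_equivariant/base_equivariant.
- exact/translate_equivariant/base_equivariant.
have E g : translate g base t = base (t^-1 * g)^-1 by rewrite /translate invgM invgK.
rewrite /pmed !E; have := hC (t^-1 * g1) (t^-1 * g2) (t^-1 * g3); have := hD t tT g1 g2 g3.
set b := base (mu _ _ _)^-1 => b1 b2.
by apply: leq_trans (tri b _ _) _; apply: leq_add.
Qed.

Lemma in_hull_near_orbit : exists C, forall phi, in_hull phi -> exists g, near C phi (translate g base).
Proof.
have [N hN] := in_hull_level; have [C0 hC0] := orbit_coarse_subalgebra.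
suff [C hC] : exists C, forall phi, level pmed orbit N phi -> exists g, near C phi (translate g base).
  by exists C => phi /hN /hC.
elim: N {hN} => [|n [C hC]].
  by exists 0%N => _ [g _ <-]; exists g => x; rewrite (gdist_refl conn).
exists (C + C + C + C0)%N => _ [a [b [c [/hC[g1 h1] /hC[g2 h2] /hC[g3 h3] ->]]]].
have [g hg] := hC0 g1 g2 g3; exists g.
exact: near_trans (near_pmed h1 h2 h3) hg.
Qed.

Lemma orbit_step : exists C, forall a s, letters S s ->
  near C (translate a base) (translate (a * s) base).
Proof.
have [C hC] := base_coarse (finite_letters hS); exists C => a s hs x.
have := hC (x^-1 * a) s hs; by rewrite /translate !invgM !invgK mulgA.
Qed.

Definition hull := {phi : G -> X | in_hull phi}.

Lemma hull_ext (x y : hull) : sval x = sval y -> x = y.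
Proof.
by case: x y => [x hx] [y hy] /= E; subst y; congr exist; apply: Prop_irrelevance.
Qed.

Definition hull_med (a b c : hull) : hull :=
  exist _ (pmed (sval a) (sval b) (sval c)) (generated_m pmed_idem (svalP a) (svalP b) (svalP c)).

Lemma hull_separated (x y : hull) : (forall h, median_hom hull_med h -> h x = h y) -> x = y.
Proof.
move=> same; apply: hull_ext; apply/funext => g; apply: (cat0_separated hX) => u v uv.
apply: (same (fun z => side u v (sval z g))) => a b c; exact: (cat0_side_hom hX uv).
Qed.

(** Additive along intervals, which is all that is needed for the algebra to be
discrete. *)
Definition hull_dist (x y : hull) : nat := (\sum_(t <- T) d (sval x t) (sval y t))%N.

Lemma hull_dist_add x y z : hull_med x y z = z -> (hull_dist x z + hull_dist z y = hull_dist x y)%N.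
Proof.
move=> /(congr1 sval) E; rewrite /hull_dist -big_split /=; apply: eq_bigr => t _.
by apply/(cat0_between hX); have := congr1 (@^~ t) E.
Qed.

Lemma hull_dist0 x y : hull_dist x y = 0%N -> x = y.
Proof.
move=> /eqP; rewrite /hull_dist sum_nat_seq_eq0 => /allP dt.
apply: hull_ext; apply: equivariant_ext => [||t tT]; try exact/in_hull_equivariant/svalP.
by apply: (gdist_eq0 conn); have := dt t tT => /eqP.
Qed.

Definition hull_complex : cubeComplex := cubulation hull_separated.

Definition hull_base : hull.
Proof. by exists (translate 1 base); exists 0%N; exists 1. Defined.

Lemma hull_CAT0 : CAT0 hull_complex.
Proof. by apply: cubulation_CAT0 hull_dist_add hull_dist0; exists hull_base. Qed.

Definition hull_act (g : G) (y : hull_complex) : hull_complex :=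
  exist _ (translate g (sval y)) (in_hull_translate g (svalP y)).

Lemma hull_act1 y : hull_act 1 y = y.
Proof. by apply: hull_ext; rewrite /= translate1. Qed.

Lemma hull_actM g h y : hull_act (g * h) y = hull_act g (hull_act h y).
Proof. by apply: hull_ext; rewrite /= translateM. Qed.

Lemma hull_act_cubical : cubical_action hull_act.
Proof.
split=> [||g n f [fmed fcov]]; [exact: hull_act1|exact: hull_actM|].
have hull_actE a b c :
    hull_act g (hull_med a b c) = hull_med (hull_act g a) (hull_act g b) (hull_act g c).
  exact: hull_ext.
split=> [x y z|x i] /=; first by rewrite fmed hull_actE.
have [ne cov] := fcov x i; split=> [E|z].
  by apply: ne; rewrite -(hull_act1 (f x)) -(mulVg g) hull_actM E -hull_actM mulVg hull_act1.
have -> : z = hull_act g (hull_act g^-1 z) by rewrite -hull_actM mulgV hull_act1.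
by rewrite -hull_actE; case: (cov (hull_act g^-1 z)) => ->; [left|right].
Qed.

(** If g x = y then y 1 = x (g^-1); writing g^-1 = t h leaves finitely many t and, by
properness of H, finitely many h. *)
Lemma finite_hull_transporter (x y : hull_complex) : finite_set [set g | hull_act g x = y].
Proof.
have finT : finite_set [set t | t \in T] by apply: finite_seq.
pose F t := (fun h : H => (t * val h)^-1) @` [set h | act h^-1 (sval x t) = sval y 1].
have finF : finite_set (\bigcup_(t in [set t | t \in T]) F t).
  apply: bigcup_finite => // t _; apply: finite_image.
  apply: (finite_injective (f := fun h : H => h^-1)) => [a b _ _ /invg_inj //|].
  apply: sub_finite_set (finite_transporter hact (sval x t) (sval y 1)).
  by move=> _ [h hh <-].
apply: sub_finite_set finF => g /(congr1 (fun z : hull_complex => sval z 1)).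
rewrite /= /translate mulg1 => gx.
have [t [h [tT /subgroup_val[k <-] E]]] := hT g^-1.
exists t => //; exists k; last by rewrite -E invgK.
by rewrite /= -gx E (in_hull_equivariant (svalP x)).
Qed.

Lemma hull_act_proper : proper_action hull_act.
Proof.
move=> K finK; pose F := \bigcup_(x in K) \bigcup_(y in K) [set g | hull_act g x = y].
have finF : finite_set F.
  by do 2!(apply: bigcup_finite => // ? _); apply: finite_hull_transporter.
by apply: sub_finite_set finF => g [x Kx Kgx]; exists x => //; exists (hull_act g x).
Qed.

(** Projection to an edge {x, y} is Lipschitz, so it cannot jump from x to y in a
step shorter than the edge. *)
Lemma near_chain C x y : near C (sval x) (sval y) \/
  forall z z' : hull, covers hull_med x y -> near C (sval z) (sval z') ->
    hull_med x y z = x -> hull_med x y z' = x.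
Proof.
case: (pselect (near C (sval x) (sval y))) => [|far]; [by left|right=> z z' [_ cov] zz' Ez].
case: (cov z') => // Ez'; case: far => w.
have := cat0_lipschitz hX (sval x w) (sval x w) (sval y w) (sval y w) (sval z w) (sval z' w).
have := congr1 (fun v : hull => sval v w) Ez; have := congr1 (fun v : hull => sval v w) Ez'.
rewrite /= /pmed => -> ->; rewrite !(gdist_refl conn) !add0n => /leq_trans; apply.
exact: zz'.
Qed.

(** A word in the generators yields a chain of orbit points from near x to near y
with steps of bounded size. *)
Lemma covers_near : exists C, forall x y : hull, covers hull_med x y -> near C (sval x) (sval y).
Proof.
have [C1 h1] := in_hull_near_orbit; have [C2 h2] := orbit_step.
exists (maxn C1 C2) => x y xy; have [//|stay] := near_chain (maxn C1 C2) x y.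
have weaken C phi psi : (C <= maxn C1 C2)%N -> near C phi psi -> near (maxn C1 C2) phi psi.
  by move=> le nr w; apply: leq_trans (nr w) le.
pose o a : hull := hull_act a hull_base.
have oE a : sval (o a) = translate a base by rewrite /= translate1.
have [a xa] := h1 _ (svalP x); have [b yb] := h1 _ (svalP y).
have [_ /(_ (a^-1 * b)) [w wS ab]] := hS.
have start : hull_med x y (o a) = x.
  apply: (stay x _ xy); last by rewrite (mC23 hull_separated) (m_id hull_separated).
  by apply: weaken (leq_maxl _ _) _; rewrite oE.
have finish : hull_med x y (o b) = x.
  have -> : b = a * (a^-1 * b) by rewrite mulVKg.
  rewrite ab; elim: w a wS {ab xa} start => [|s w IH] a wS start.
    by rewrite big_nil mulg1.
  rewrite big_cons mulgA; apply: IH => [z zw|]; first by apply: wS; rewrite inE zw orbT.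
  apply: (stay _ _ xy _ start); apply: weaken (leq_maxr _ _) _; rewrite !oE; apply: h2.
  by apply: wS; rewrite inE eqxx.
(* The projection of the chain has stayed at x up to the other end y. *)
have yE : hull_med x y y = x.
  apply: (stay _ _ xy _ finish); apply: weaken (leq_maxl _ _) _; rewrite oE; exact: near_sym.
have [+ _] := xy; case; rewrite -yE.
by rewrite (mC12 hull_separated) (mC23 hull_separated) (m_id hull_separated).
Qed.

Lemma finite_hull_ball R (y : hull) : finite_set [set z : hull | near R (sval y) (sval z)].
Proof.
apply: (finite_injective (f := sval)) => [a b _ _ /hull_ext //|].
apply: sub_finite_set (finite_near R (sval y)) => _ [z yz <-]; split=> //.
exact/in_hull_equivariant/svalP.
Qed.

(** Edges are bounded and every vertex is near the orbit, so after a translation the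
neighbours of one corner of a cube lie in a fixed finite ball. This bounds the
dimension of cubes and hence their diameter. *)
Lemma hull_act_cocompact : cocompact_action hull_act.
Proof.
have [C1 h1] := in_hull_near_orbit; have [C2 h2] := covers_near.
have [N hN] := finite_dimension hull_base (finite_hull_ball (C1 + C2) hull_base).
exists [set y : hull_complex | near (C1 + N * C2) (sval hull_base) (sval y)].
  exact: finite_hull_ball.
move=> n f cf; have [fmed fcov] := cf; pose o : {ffun 'I_n -> bool} := [ffun=> false].
have [a fa] := h1 _ (svalP (f o)).
have moved R y : near R (sval y) (translate a base) -> near R (sval hull_base) (sval (hull_act a^-1 y)).
  by move=> ya; apply: near_sym; rewrite /= translate1; apply: near_translateV.
have nN : (n <= N)%N.
  apply: (hN n (fun i => hull_act a^-1 (f (toggle o i)))) => [i j E|i].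
    have {}E : f (toggle o i) = f (toggle o j).
      by rewrite -[LHS]hull_act1 -[RHS]hull_act1 -(mulgV a) !hull_actM E.
    have := congr1 (fun u : {ffun 'I_n -> bool} => u i) (median_cube_inj hull_separated cf E).
    by rewrite !ffunE eqxx => /esym/eqP.
  apply: moved; rewrite addnC; apply: near_trans fa; apply: near_sym; apply: h2; exact: fcov.
exists a^-1 => u; apply: moved.
have dist k : forall v : {ffun 'I_n -> bool}, (#|[pred i | v i]| <= k)%N ->
    near (k * C2) (sval (f v)) (sval (f o)).
  elim: k => [|k IH] v vk.
    have -> : v = o.
      apply/ffunP => i; rewrite ffunE; apply/negbTE/negP => vi.
      by move: vk; rewrite leqn0 => /eqP/card0_eq/(_ i); rewrite !inE vi.
    by move=> w; rewrite (gdist_refl conn).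
  case: (pickP [pred i | v i]) => [i /= vi|none]; last first.
    have v0 : (#|[pred i | v i]| <= k)%N by rewrite eq_card0.
    by move=> w; apply: leq_trans (IH v v0 w) _; rewrite leq_mul2r leqnSn orbT.
  rewrite mulSn; apply: (near_trans (psi := sval (f (toggle v i)))).
    by apply: h2; apply: fcov.
  apply: IH; rewrite -ltnS; apply: leq_trans vk; apply: proper_card; apply/properP; split.
    by apply/fintype.subsetP => j; rewrite !inE ffunE; case: (eqVneq j i) => [->|]; rewrite ?addbF.
  by exists i; rewrite !inE // ffunE vi eqxx.
(* From the origin of the cube to u there are at most n edges. *)
have un : (#|[pred i | u i]| <= n)%N by rewrite -[n in (_ <= n)%N]card_ord max_card.
have := near_trans (dist n u un) fa => nr w; apply: leq_trans (nr w) _.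
by rewrite addnC leq_add2l leq_mul2r nN orbT.
Qed.

End Coarse.

End Coinduction.

Theorem corollary7 (G : groupType) (P : pred G) (H : subGroupType P)
    (hfi : finite_index P)
    (X : cubeComplex) (hX : CAT0 X)
    (act : H -> X -> X) (hact : proper_cocompact_cubical_action act)
    (S : set G) (hS : finite_generating_set S)
    (mu : G -> G -> G -> G) (hmu : induced_coarse_median S act mu)
    (hinv : left_invariant S mu) :
  exists (Y : cubeComplex) (actY : G -> Y -> Y),
    CAT0 Y /\ proper_cocompact_cubical_action actY.
Proof.
have [_ /finite_seqP[T ->] hT] := hfi.
have [p [muH [r [hmuH hr hclose]]]] := hmu.
exists (hull_complex T hX act p), (@hull_act _ _ _ _ _ _ _ _); split; first exact: hull_CAT0.
split; first exact: hull_act_cubical.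
  exact: (hull_act_proper hT).
exact: (hull_act_cocompact hT hX hact hS hmuH hr hclose hinv).
Qed.
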